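(* Let $a \geq 1$ and $q \geq 1$ be fixed integers with $\gcd(a,q) = 1$. Then the Diophantine equation $y = qx + a$ has infinitely many solutions with $y = p$ a prime number as $x \in \mathbb{Z}$ varies over the integers. *)

(* Defs.v *)
From HB Require Import structures.
From mathcomp Require Import all_boot all_order all_algebra.
From mathcomp Require Import classical_sets cardinality.

Set Implicit Arguments.
Unset Strict Implicit.
Unset Printing Implicit Defensive.

Import Order.TTheory GRing.Theory Num.Theory.

Local Open Scope ring_scope.
Local Open Scope classical_set_scope.

(* [prime] is a predicate on [nat]: the value y is required to be a positive
   prime, although x, and hence y, range over all of [int]. *)
Definition prime_solutions (a q : int) : set (int * int) :=
  [set xy | xy.2 = q * xy.1 + a /\ exists2 p : nat, prime p & xy.2 = p%:Z].

(* Main.v *)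
(* This is Dirichlet's theorem, proved along the lines of Shapiro with finite sums
   only. For a character chi mod q put L_N = sum_(n <= N) chi(n)/n and
   T_N = sum_(n <= N) chi(n) Lambda(n)/n. Moebius inversion expresses T_N through
   the L_(N/d); since |L_M - L_m| <= 2q/(m+1) for chi nonprincipal, T_N is bounded
   when L_N stays away from 0, and T_N = - log N + O(1) when L_N tends to 0. The
   second case is impossible: for real chi by Monsky's argument with Lambert
   series, otherwise because the conjugate of chi would vanish as well, making
   the nonnegative sum of all T_N tend to - infinity. Orthogonality of the
   characters then turns the divergence of T_N for the principal character into
   that of sum Lambda(n)/n over n = a mod q, while the prime powers n = p^k with
   k >= 2 contribute O(1). *)
Require Import Defs.
From HB Require Import structures.
From mathcomp Require Import all_boot all_order all_algebra.
From mathcomp Require Import classical_sets cardinality.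
From mathcomp Require Import all_fingroup all_solvable all_field all_character.
From mathcomp Require Import boolp reals sequences exp Rstruct complex.
From mathcomp Require Import ring lra zify.

Set Implicit Arguments.
Unset Strict Implicit.
Unset Printing Implicit Defensive.

Import Order.TTheory GRing.Theory Num.Theory.
Import Normc.

Local Open Scope ring_scope.
Local Open Scope complex_scope.

(** * Divisor sums and arithmetic functions *)

Section Divisors.

(** A divisor of p^(k+1) m that p^(k+1) does not divide has at most k factors p, so it divides p^k m
    already; the others are p^(k+1) times a divisor of m. *)
Lemma perm_divisors_pfactor (p k m : nat) : prime p -> ~~ (p %| m)%N -> (0 < m)%N ->
  perm_eq (divisors (p ^ k.+1 * m))
          (divisors (p ^ k * m) ++ [seq (p ^ k.+1 * d)%N | d <- divisors m]).
Proof.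
move=> p_pr pNm m0; have p0 := prime_gt0 p_pr.
have pk0 j : (0 < p ^ j)%N by rewrite expn_gt0 p0.
apply: uniq_perm; first exact: divisors_uniq.
  rewrite cat_uniq divisors_uniq map_inj_uniq ?divisors_uniq ?andbT /=; last first.
    by move=> x y /eqP; rewrite eqn_pmul2l// => /eqP.
  apply/hasPn => _ /mapP[d dm ->]; rewrite -dvdn_divisors ?muln_gt0 ?pk0//.
  apply: contra pNm => /(dvdn_trans (dvdn_mulr d (dvdnn _))).
  by rewrite expnSr dvdn_pmul2l.
move=> d; rewrite mem_cat -!dvdn_divisors ?muln_gt0 ?pk0//.
apply/idP/orP => [dv|[|/mapP[e em ->]]].
- have [pd|pNd] := boolP (p ^ k.+1 %| d)%N.
    right; case/dvdnP: pd dv => e ->; rewrite mulnC dvdn_pmul2l// => em.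
    by apply/mapP; exists e => //; rewrite -dvdn_divisors.
  left; have d0 : (0 < d)%N by apply: dvdn_gt0 dv; rewrite muln_gt0 pk0.
  rewrite pfactor_dvdn// -leqNgt in pNd.
  have [e cpe de] := pfactor_coprime p_pr d0.
  rewrite de mulnC; apply: dvdn_mul; first by rewrite dvdn_Pexp2l ?prime_gt1.
  have : (e %| p ^ k.+1 * m)%N.
    by apply: dvdn_trans dv; rewrite de dvdn_mulr.
  by rewrite Gauss_dvdr// coprimeXr// coprime_sym.
- by move=> /dvdn_trans -> //; rewrite expnS -mulnA dvdn_mull.
- by rewrite dvdn_pmul2l// dvdn_divisors.
Qed.

Lemma pfactor_ind (P : nat -> Prop) : P 1%N ->
  (forall p k m, prime p -> ~~ (p %| m)%N -> (0 < m)%N -> P m -> P (p ^ k.+1 * m)%N) ->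
  forall n, (0 < n)%N -> P n.
Proof.
move=> P1 PS; elim/ltn_ind => n IH n0.
have [->//|n1] := eqVneq n 1%N.
have ngt1 : (1 < n)%N by rewrite ltn_neqAle eq_sym n1.
have p_pr := pdiv_prime ngt1; set p := pdiv n in p_pr.
have [m cpm nE] := pfactor_coprime p_pr n0.
have: (0 < logn p n)%N by rewrite logn_gt0 mem_primes p_pr n0 pdiv_dvd.
case: (logn p n) nE => // k nE _; rewrite nE mulnC.
have m0 : (0 < m)%N by move: n0; rewrite nE muln_gt0 => /andP[].
apply: PS => //; first by rewrite -prime_coprime.
apply: IH => //; rewrite nE ltn_Pmulr//.
by rewrite -(exp1n k.+1) ltn_exp2r ?prime_gt1.
Qed.

Lemma big_divisors_pfactor (V : nmodType) (F : nat -> V) (p k m : nat) :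
  prime p -> ~~ (p %| m)%N -> (0 < m)%N ->
  \sum_(d <- divisors (p ^ k.+1 * m)) F d =
  \sum_(d <- divisors (p ^ k * m)) F d +
  \sum_(d <- divisors m) F (p ^ k.+1 * d)%N.
Proof.
by move=> *; rewrite (perm_big _ (perm_divisors_pfactor _ _ _ _))//= big_cat/= big_map.
Qed.

Lemma big_divisors_rev (V : nmodType) (F : nat -> V) (n : nat) : (0 < n)%N ->
  \sum_(d <- divisors n) F (n %/ d)%N = \sum_(d <- divisors n) F d.
Proof.
move=> n0; rewrite -(big_map (fun d => n %/ d)%N xpredT F); apply: perm_big.
have K x : (x %| n)%N -> (n %/ (n %/ x) = x)%N by move=> xn; rewrite divnA// mulKn.
have inj : {in divisors n &, injective (fun d => n %/ d)%N}.
  by move=> x y; rewrite -!dvdn_divisors// => /K {2}<- /K {2}<- ->.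
apply: uniq_perm; rewrite ?map_inj_in_uniq ?divisors_uniq// => d.
apply/mapP/idP => [[e en ->]|dn].
  by move: en; rewrite -!dvdn_divisors//; apply: dvdn_div.
exists (n %/ d)%N; move: dn; rewrite -!dvdn_divisors//; first exact: dvdn_div.
by move/K.
Qed.

(** Both sides run over the pairs with d c <= N. In the induction, passing to [N.+1] raises N/d by
    one exactly when d divides [N.+1]. *)
Lemma sum_dirichlet_regroup (V : nmodType) (F : nat -> nat -> V) (N : nat) :
  \sum_(1 <= d < N.+1) \sum_(1 <= c < (N %/ d).+1) F d c =
  \sum_(1 <= n < N.+1) \sum_(d <- divisors n) F d (n %/ d)%N.
Proof.
elim: N => [|N IH]; first by rewrite !big_geq.
rewrite [RHS]big_nat_recr//= -IH.
transitivity (\sum_(1 <= d < N.+2) (\sum_(1 <= c < (N %/ d).+1) F d c +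
    if (d %| N.+1)%N then F d (N.+1 %/ d)%N else 0)).
  apply: eq_big_nat => d /andP[d0 dN]; rewrite divnS//.
  case: (d %| N.+1)%N => /=; rewrite ?addr0// add1n.
  by rewrite big_nat_recr.
rewrite big_split/=; congr (_ + _).
  by rewrite big_nat_recr//= divn_small// [X in _ + X]big_geq// addr0.
rewrite -big_mkcond -big_filter; apply: perm_big; apply: uniq_perm.
- by rewrite filter_uniq ?iota_uniq.
- exact: divisors_uniq.
move=> d; rewrite mem_filter mem_index_iota -dvdn_divisors//.
case: (boolP (d %| N.+1)%N) => //= dN.
by apply/andP; split; [exact: dvdn_gt0 dN | rewrite ltnS dvdn_leq].
Qed.

End Divisors.

(** * The Moebius function *)

Section Moebius.
Variable K : comNzRingType.

Definition moebius (n : nat) : K := \prod_(p <- primes n) - (logn p n == 1%N)%:R.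

Lemma moebius1 : moebius 1 = 1.
Proof. by rewrite /moebius big_nil. Qed.

Lemma moebius_pfactor (p k m : nat) : prime p -> ~~ (p %| m)%N -> (0 < m)%N ->
  moebius (p ^ k.+1 * m)%N = - (k == 0)%:R * moebius m.
Proof.
move=> p_pr pNm m0.
have pk0 : (0 < p ^ k.+1)%N by rewrite expn_gt0 prime_gt0.
have perm : perm_eq (primes (p ^ k.+1 * m)) (p :: primes m).
  apply: uniq_perm; rewrite /= ?primes_uniq ?andbT//.
    by rewrite mem_primes p_pr m0.
  by move=> r; rewrite primesM// primesX// primes_prime// !inE.
have logE r : r \in primes m -> logn r (p ^ k.+1 * m) = logn r m.
  move=> rm; rewrite lognM// lognX logn_prime//.
  by case: eqVneq rm => [->|]; rewrite ?muln0// mem_primes (negPf pNm) !andbF.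
rewrite /moebius (perm_big _ perm)/= big_cons; congr (_ * _).
  rewrite lognM// pfactorK// lognE (negPf pNm) !andbF addn0 eqSS.
  by [].
by apply: eq_big_seq => r rm; rewrite logE.
Qed.

(** When the first factor p is adjoined to m, the divisors p d cancel the divisors d; every further
    factor p adds only divisors with mu = 0. *)
Lemma sum_moebius (n : nat) : (0 < n)%N ->
  \sum_(d <- divisors n) moebius d = (n == 1%N)%:R.
Proof.
elim/pfactor_ind => [|p k m p_pr pNm m0 IH]; first by rewrite big_seq1 moebius1.
have -> : (p ^ k.+1 * m == 1)%N = false.
  by rewrite expnS -mulnA muln_eq1 gtn_eqF ?prime_gt1.
have E j : \sum_(d <- divisors m) moebius (p ^ j.+1 * d)%N =
    - (j == 0)%:R * \sum_(d <- divisors m) moebius d.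
  rewrite mulr_sumr; apply: eq_big_seq => d; rewrite -dvdn_divisors// => dm.
  by rewrite moebius_pfactor ?(dvdn_gt0 m0)//; apply: contra pNm => /dvdn_trans->.
elim: k => [|k IHk]; rewrite big_divisors_pfactor// E.
  by rewrite mul1n mulN1r subrr.
by rewrite IHk oppr0 mul0r addr0.
Qed.

End Moebius.

Lemma normr_moebius (K : numDomainType) (n : nat) : `|moebius K n| <= 1.
Proof.
rewrite /moebius; elim/big_ind: _ => [|x y x1 y1|p _]; first by rewrite normr1.
  by rewrite normrM mulr_ile1.
by rewrite normrN; case: eqP; rewrite ?normr1 ?normr0.
Qed.

(** * The von Mangoldt function *)

Section VonMangoldt.
Variable R : realType.

(** The test says that n > 1 is a power of its least prime factor. *)
Definition mangoldt (n : nat) : R :=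
  if (1 < n)%N && (pdiv n).-nat n then ln (pdiv n)%:R else 0.

Lemma mangoldt_pfactor (p k d : nat) : prime p -> ~~ (p %| d)%N -> (0 < d)%N ->
  mangoldt (p ^ k.+1 * d) = if d == 1%N then ln p%:R else 0.
Proof.
move=> p_pr pNd d0; rewrite /mangoldt.
have pk1 : (1 < p ^ k.+1)%N by rewrite -(exp1n k.+1) ltn_exp2r ?prime_gt1.
have n1 : (1 < p ^ k.+1 * d)%N by rewrite (leq_trans pk1)// leq_pmulr.
rewrite n1/=; case: eqVneq => [->|d1].
  by rewrite muln1 pdiv_pfactor// pnatX pnat_id.
case: ifP => // nat_n; exfalso.
have pr := pdiv_prime n1; set r := pdiv _ in nat_n pr.
move: nat_n; rewrite pnatM pnatX orbF => /andP[+ rd].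
rewrite pnatE// inE => /eqP pr_eq; rewrite -pr_eq in rd.
have dgt1 : (1 < d)%N by rewrite ltn_neqAle eq_sym d1.
move: (pnatP _ d0 rd _ (pdiv_prime dgt1) (pdiv_dvd d)); rewrite inE => /eqP E.
by move: pNd; rewrite -E pdiv_dvd.
Qed.

Lemma mangoldt_ge0 n : 0 <= mangoldt n.
Proof. by rewrite /mangoldt; case: ifP => // /andP[n1 _]; rewrite ln_ge0// ler1n pdiv_gt0. Qed.

(** Among the new divisors p^(j+1) d only d = 1 gives a prime power, so each factor p adds log p. *)
Lemma sum_mangoldt (n : nat) : (0 < n)%N ->
  \sum_(d <- divisors n) mangoldt d = ln n%:R.
Proof.
elim/pfactor_ind => [|p k m p_pr pNm m0 IH]; first by rewrite big_seq1 /mangoldt/= ln1.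
have E j : \sum_(d <- divisors m) mangoldt (p ^ j.+1 * d)%N = ln p%:R.
  rewrite (bigD1_seq 1%N) ?divisors_uniq -?dvdn_divisors ?dvd1n//= mangoldt_pfactor//; last first.
    by rewrite -(prednK (prime_gt0 p_pr)) dvdn1 prednK ?prime_gt0// gtn_eqF ?prime_gt1.
  rewrite big_seq_cond big1 ?addr0// => d; rewrite -dvdn_divisors// => /andP[dm d1].
  rewrite mangoldt_pfactor ?(negPf d1) ?(dvdn_gt0 m0)//.
  by apply: contra pNm => /dvdn_trans->.
have p0 : (0 : R) < p%:R by rewrite ltr0n prime_gt0.
have lnE j : ln (p ^ j * m)%:R = j%:R * ln p%:R + ln m%:R :> R.
  by rewrite natrM natrX lnM ?posrE ?exprn_gt0 ?ltr0n ?(prime_gt0 p_pr)// lnXn// mulr_natl.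
rewrite lnE; elim: k => [|k IHk]; rewrite big_divisors_pfactor// E.
  by rewrite mul1n IH addrC mul1r.
by rewrite IHk [in RHS]mulrSr; ring.
Qed.

End VonMangoldt.

(** * Logarithms and summation by parts *)

Section Logarithm.
Variable R : realType.
Implicit Types n : nat.

Lemma ln_succ n : (0 < n)%N -> n%:R * (ln n.+1%:R - ln n%:R) <= 1 :> R.
Proof.
move=> n0; have n0R : (0 : R) < n%:R by rewrite ltr0n.
rewrite -ler_pdivlMl// mulr1 -ln_div ?posrE ?ltr0n//.
have -> : n.+1%:R / n%:R = 1 + n%:R^-1 :> R by rewrite mulrS mulrDl divff ?lt0r_neq0// addrC mul1r.
by apply: le_ln1Dx; rewrite (@lt_trans _ _ 0)// ?oppr_lt0 ?ltr01// invr_gt0.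
Qed.

Lemma lnn_ge0 n : 0 <= ln n%:R :> R.
Proof. by case: n => [|n]; [rewrite ln0 | rewrite ln_ge0// ler1n]. Qed.

Lemma ler_lnn m n : (0 < m)%N -> (m <= n)%N -> ln m%:R <= ln n%:R :> R.
Proof. by move=> m0 mn; rewrite ler_ln ?posrE ?ltr0n ?ler_nat// (leq_trans m0). Qed.

(** A crude Stirling bound for log n!, enough to bound the mean of log (n/d) over d <= n by 1. *)
Lemma sum_ln_ge n : n%:R * ln n%:R - n%:R <= \sum_(1 <= d < n.+1) ln d%:R :> R.
Proof.
elim: n => [|n IH]; first by rewrite big_geq// mul0r subrr.
rewrite big_nat_recr//=; apply: le_trans (lerD IH (lexx _)).
case: n {IH} => [|n]; first by rewrite ln1 !mulr0 !mul0r; lra.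
by have := @ln_succ n.+1 isT; rewrite [n.+2%:R]mulrS; lra.
Qed.

Lemma sum_ln_quot n : \sum_(1 <= d < n.+1) (ln n%:R - ln d%:R) <= n%:R :> R.
Proof.
rewrite sumrB sumr_const_nat subSS subn0 -[ln _ *+ _]mulr_natl.
by have := sum_ln_ge n; lra.
Qed.

(* The summand 1 makes log n / n decreasing from n = 1 on. *)
Definition glog n : R := (1 + ln n%:R) / n%:R.

Lemma glog_ge0 n : 0 <= glog n.
Proof. by rewrite /glog divr_ge0// addr_ge0// lnn_ge0. Qed.

Lemma glog_decr n : (0 < n)%N -> glog n.+1 <= glog n.
Proof.
move=> n0; rewrite /glog ler_pdivrMr ?ltr0n// mulrAC ler_pdivlMr ?ltr0n//.
have := ln_succ n0; have := lnn_ge0 n; have := @lnn_ge0 n.+1.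
have : 0 < n%:R :> R by rewrite ltr0n.
by rewrite [n.+1%:R in X in _ <= X]mulrS; nra.
Qed.

End Logarithm.

(** * Abel summation with complex coefficients *)

Section Abel.
Variable R : realType.

Lemma normc_real (x : R) : normc x%:C = `|x|.
Proof. by rewrite /normc/= expr0n/= addr0 sqrtr_sqr. Qed.

Lemma normc_ge0 (z : R[i]) : 0 <= normc z.
Proof. by case: z => x y; rewrite /normc sqrtr_ge0. Qed.

Lemma normcD (x y : R[i]) : normc (x + y) <= normc x + normc y.
Proof. exact: le_normcD. Qed.

Lemma normcB (x y : R[i]) : normc (x - y) <= normc x + normc y.
Proof. by apply: le_trans (normcD _ _) _; rewrite lerD2l (normcN y). Qed.

Lemma normc_sum I (r : seq I) (P : pred I) (F : I -> R[i]) :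
  normc (\sum_(i <- r | P i) F i) <= \sum_(i <- r | P i) normc (F i).
Proof.
elim/big_rec2: _ => [|i y x _ le]; first by rewrite normc0.
by apply: le_trans (normcD _ _) _; rewrite lerD2l.
Qed.

Lemma Re_le_normc (z : R[i]) : complex.Re z <= normc z.
Proof.
case: z => x y /=; rewrite (le_trans (ler_norm x))// -sqrtr_sqr ler_wsqrtr//.
by rewrite lerDl sqr_ge0.
Qed.

(** Summation by parts: the partial sums of a are weighted by f n and by the differences f k - f
    (k+1), which are nonnegative with total f m. *)
Lemma abel (a : nat -> R[i]) (f : nat -> R) (Q : R) (m n : nat) : (m <= n)%N ->
  (forall j, normc (\sum_(m <= k < j) a k) <= Q) ->
  (forall k, (m <= k)%N -> f k.+1 <= f k) ->
  (forall k, (m <= k)%N -> 0 <= f k) ->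
  normc (\sum_(m <= k < n) a k * (f k)%:C) <= Q * f m.
Proof.
move=> mn aQ f_decr f_ge0; set B := fun j => \sum_(m <= k < j) a k.
have -> : \sum_(m <= k < n) a k * (f k)%:C =
    B n * (f n)%:C + \sum_(m <= k < n) B k.+1 * (f k - f k.+1)%:C.
  elim: n mn => [|n IH]; first by rewrite leqn0 => /eqP->; rewrite /B !big_geq// mul0r addr0.
  rewrite leq_eqVlt => /orP[/eqP<-|]; first by rewrite /B !big_geq// mul0r addr0.
  rewrite ltnS => mn; rewrite !big_nat_recr//= IH// {3}/B [in RHS]/B big_nat_recr//=.
  by rewrite -/(B n) !rmorphB/=; ring.
apply: le_trans (normcD _ _) _.
have -> : Q * f m = Q * f n + \sum_(m <= k < n) Q * (f k - f k.+1).
  rewrite -mulr_sumr -[X in _ + Q * X]opprK -sumrN.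
  by under eq_bigr do rewrite opprB; rewrite telescope_sumr//; ring.
apply: lerD.
  by rewrite normcM normc_real ger0_norm ?f_ge0// ler_wpM2r ?f_ge0// aQ.
apply: le_trans (normc_sum _ _ _) _.
apply: ler_sum_nat => k /andP[mk _].
rewrite normcM normc_real ger0_norm ?subr_ge0 ?f_decr//.
by rewrite ler_wpM2r ?aQ// subr_ge0 f_decr.
Qed.

End Abel.

(** * Sums twisted by a completely multiplicative function *)

Section TwistedSums.
Variable R : realType.
Implicit Types (chi : nat -> R[i]) (N : nat).

Definition twist chi n : R[i] := chi n * (n%:R^-1 : R)%:C.

Definition Lsum chi N := \sum_(1 <= n < N.+1) twist chi n.

Definition mangoldt_sum chi N := \sum_(1 <= n < N.+1) twist chi n * (mangoldt R n)%:C.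

Variables (chi : nat -> R[i]) (Q : R).
Hypothesis chi1 : chi 1%N = 1.
Hypothesis chiM : forall m n, chi (m * n)%N = chi m * chi n.
Hypothesis chi_le1 : forall n, normc (chi n) <= 1.
Hypothesis chi_sum : forall m n, normc (\sum_(m <= k < n) chi k) <= Q.

Lemma twist1 : twist chi 1%N = 1.
Proof. by rewrite /twist chi1 invr1 mul1r. Qed.

Lemma twistM m n : twist chi (m * n) = twist chi m * twist chi n.
Proof. by rewrite /twist chiM natrM invfM rmorphM/=; ring. Qed.

Lemma normc_twist n : normc (twist chi n) <= n%:R^-1.
Proof.
by rewrite /twist normcM normc_real ger0_norm ?invr_ge0// ler_piMl ?invr_ge0.
Qed.

Lemma Q_ge0 : 0 <= Q.
Proof. exact: le_trans (normc_ge0 _) (chi_sum 0 0). Qed.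

Definition moebius_twist d : R[i] := moebius _ d * twist chi d.

Lemma normc_moebius_twist d : normc (moebius_twist d) <= d%:R^-1.
Proof.
rewrite /moebius_twist normcM; apply: le_trans (normc_twist d).
have := normr_moebius R[i] d; rewrite -[`|_|]/((normc (moebius _ d))%:C) lecR => h.
by rewrite ler_piMl// normc_ge0.
Qed.

(* Grouping by n = d c, the factor sum_(d | n) mu(d) kills every n but 1. *)
Lemma moebius_cancel (Phi : nat -> R[i]) N : (0 < N)%N ->
  \sum_(1 <= d < N.+1) moebius_twist d * (\sum_(1 <= c < (N %/ d).+1) twist chi c * Phi (d * c)%N)
  = Phi 1%N.
Proof.
move=> N0; under eq_bigr do rewrite mulr_sumr.
rewrite sum_dirichlet_regroup big_nat_recl//= big_seq1 /moebius_twist moebius1 divn1 twist1 !mul1r.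
rewrite big_nat_cond big1 ?addr0// => n /andP[/andP[n0 _] _].
transitivity (\sum_(d <- divisors n.+1) moebius _ d * (twist chi n.+1 * Phi n.+1)).
  apply: eq_big_seq => d; rewrite -dvdn_divisors// => dn.
  have E : (d * (n.+1 %/ d) = n.+1)%N by rewrite mulnC divnK.
  by rewrite -mulrA (mulrA (twist chi d)) -twistM E.
by rewrite -mulr_suml sum_moebius// eqSS (gtn_eqF n0) mul0r.
Qed.

(** The partial sums of the series for -L'(1, chi). *)
Definition Hsum N := \sum_(1 <= n < N.+1) twist chi n * (ln n%:R : R)%:C.

(** This is log = 1 * Lambda, twisted by the completely multiplicative chi(n)/n. *)
Lemma Hsum_conv N :
  Hsum N = \sum_(1 <= c < N.+1) twist chi c * mangoldt_sum chi (N %/ c).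
Proof.
under [RHS]eq_bigr do rewrite mulr_sumr.
rewrite sum_dirichlet_regroup; apply: eq_big_nat => n /andP[n0 _].
transitivity (\sum_(d <- divisors n) twist chi n * (mangoldt R (n %/ d))%:C); last first.
  apply: eq_big_seq => d; rewrite -dvdn_divisors// => dn.
  have E : (d * (n %/ d) = n)%N by rewrite mulnC divnK.
  by rewrite mulrA -twistM E.
rewrite -mulr_sumr -rmorph_sum/=; congr (_ * _%:C).
by rewrite (big_divisors_rev (mangoldt R) n0) sum_mangoldt.
Qed.

Lemma mangoldt_sum_inv N : (0 < N)%N ->
  \sum_(1 <= d < N.+1) moebius_twist d * Hsum (N %/ d) = mangoldt_sum chi N.
Proof.
move=> N0; rewrite -[in RHS](divn1 N).
rewrite -(moebius_cancel (fun n => mangoldt_sum chi (N %/ n)) N0).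
apply: eq_bigr => d _; rewrite Hsum_conv; congr (_ * _).
by apply: eq_bigr => c _; rewrite divnMA.
Qed.

Lemma Lsum_inv N : (0 < N)%N ->
  \sum_(1 <= d < N.+1) moebius_twist d * Lsum chi (N %/ d) = 1.
Proof.
move=> N0; rewrite -[RHS](moebius_cancel (fun=> 1) N0).
by apply: eq_bigr => d _; congr (_ * _); apply: eq_bigr => c _; rewrite mulr1.
Qed.

(** Moebius cancellation for Phi n = log (N/n): as log (N/(d c)) = log (N/d) - log c, the inner sum
    is log (N/d) L_(N/d) - H_(N/d), and the H terms add up to T_N. *)
Lemma Lsum_log_inv N : (0 < N)%N ->
  \sum_(1 <= d < N.+1) moebius_twist d * ((ln N%:R - ln d%:R : R)%:C * Lsum chi (N %/ d))
  = (ln N%:R)%:C + mangoldt_sum chi N.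
Proof.
move=> N0; rewrite -mangoldt_sum_inv//.
have := moebius_cancel (fun n => (ln N%:R - ln n%:R : R)%:C) N0.
rewrite ln1 subr0 => <-; rewrite -big_split/=.
apply: eq_big_nat => d /andP[d0 _]; rewrite -mulrDr; congr (_ * _).
rewrite /Lsum /Hsum mulr_sumr -big_split/=.
apply: eq_big_nat => c /andP[c0 _].
by rewrite natrM lnM ?posrE ?ltr0n// !rmorphB rmorphD/=; ring.
Qed.

Lemma Lsum_tail m n : (m <= n)%N -> normc (Lsum chi n - Lsum chi m) <= Q / m.+1%:R.
Proof.
move=> mn; rewrite /Lsum (big_cat_nat (n := m.+1))//= [X in normc X]addrC addKr.
apply: abel => // k mk; last by rewrite invr_ge0.
by rewrite lef_pV2 ?posrE ?ltr0n ?ler_nat// (leq_trans _ mk).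
Qed.

(** The sum of [Lsum] and [Hsum], so that chi(n) carries the weight [glog] n, to which [abel]
    applies. *)
Definition Gsum N := \sum_(1 <= n < N.+1) twist chi n * (1 + ln n%:R : R)%:C.

Lemma Gsum_tail m n : (m <= n)%N -> normc (Gsum n - Gsum m) <= Q * glog R m.+1.
Proof.
move=> mn; rewrite /Gsum (big_cat_nat (n := m.+1))//= [X in normc X]addrC addKr.
under eq_bigr => k _ do
  rewrite /twist -mulrA -rmorphM/= mulrC -[_ * _]mulrC [X in _ * X%:C]mulrC -/(glog R k).
apply: abel => // k mk; [apply: glog_decr; exact: leq_trans mk | exact: glog_ge0].
Qed.

Lemma inv_mul_quot_le N d : (0 < N)%N -> (0 < d)%N ->
  d%:R^-1 * (N %/ d).+1%:R^-1 <= N%:R^-1 :> R.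
Proof.
move=> N0 d0; rewrite -invfM -natrM lef_pV2 ?posrE ?ltr0n ?muln_gt0 ?d0// ler_nat.
by rewrite mulnC ltnW// ltn_ceil.
Qed.

(** The factor 1/d from mu(d) chi(d)/d meets the decay 1/(N/d + 1) of a tail bound; together they
    are at most 1/N, so the total is the mean of f over d <= N. *)
Lemma sum_moebius_twist_le (F : nat -> R[i]) (f : nat -> R) N : (0 < N)%N ->
  (forall d, (0 < d <= N)%N -> normc (F d) <= f d / (N %/ d).+1%:R) ->
  normc (\sum_(1 <= d < N.+1) moebius_twist d * F d) <= (\sum_(1 <= d < N.+1) f d) / N%:R.
Proof.
move=> N0 Ff; apply: le_trans (normc_sum _ _ _) _.
rewrite mulr_suml.
apply: ler_sum_nat => d /andP[d0 dN]; rewrite normcM.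
have {}Ff := Ff d; rewrite d0 /= -ltnS dN in Ff; have {}Ff := Ff isT.
have f0 : 0 <= f d.
  by have := le_trans (normc_ge0 _) Ff; rewrite pmulr_lge0// invr_gt0 ltr0n.
apply: (@le_trans _ _ (d%:R^-1 * (f d / (N %/ d).+1%:R))).
  by apply: ler_pM; rewrite ?normc_ge0// normc_moebius_twist.
by rewrite mulrCA ler_wpM2l// inv_mul_quot_le.
Qed.

(** In [Lsum_log_inv] the decay of L_(N/d) leaves Q times the mean of log (N/d), and that mean is at
    most 1. *)
Lemma mangoldt_sum_vanishing : (forall m, normc (Lsum chi m) <= Q / m.+1%:R) ->
  forall N, (0 < N)%N -> normc ((ln N%:R)%:C + mangoldt_sum chi N) <= Q.
Proof.
move=> LQ N N0; rewrite -Lsum_log_inv//.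
have le_ln d : (0 < d <= N)%N -> 0 <= ln N%:R - ln d%:R :> R.
  by move=> /andP[d0 dN]; rewrite subr_ge0 ler_lnn.
apply: le_trans (@sum_moebius_twist_le _ (fun d => (ln N%:R - ln d%:R) * Q) _ N0 _) _.
  move=> d dN; rewrite normcM normc_real ger0_norm ?le_ln// -mulrA.
  by rewrite ler_wpM2l ?le_ln.
rewrite -mulr_suml ler_pdivrMr ?ltr0n// mulrC ler_wpM2l ?Q_ge0//.
exact: sum_ln_quot.
Qed.

(** First M = sum mu(d) chi(d)/d is bounded, because M L_n differs from 1 by at most Q. Then H = G -
    L turns T_N into M G_N - 1, up to the differences G_N - G_(N/d), which are tails. *)
Lemma mangoldt_sum_nonvanishing m0 (c : R) : 0 < c ->
  (forall m, (m0 <= m)%N -> c <= normc (Lsum chi m)) ->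
  exists K : R, forall N, (0 < N)%N -> normc (mangoldt_sum chi N) <= K.
Proof.
move=> c0 cL; exists (1 + Q * ((1 + Q) / c) + 3 * Q) => N N0.
have N0R : (0 : R) < N%:R by rewrite ltr0n.
pose M := \sum_(1 <= d < N.+1) moebius_twist d.
have M_le : normc M <= (1 + Q) / c.
  (* n >= N makes each L_n - L_(N/d) a tail, and n >= m0 keeps |L_n| above c. *)
  pose n := maxn N m0; have Nn : (N <= n)%N by rewrite leq_maxl.
  have nL : c <= normc (Lsum chi n) by rewrite cL ?leq_maxr.
  rewrite ler_pdivlMr//; apply: le_trans (ler_wpM2l (normc_ge0 M) nL) _.
  rewrite -normcM.
  have -> : M * Lsum chi n =
      1 + \sum_(1 <= d < N.+1) moebius_twist d * (Lsum chi n - Lsum chi (N %/ d)).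
    rewrite -(Lsum_inv N0) -big_split/= mulr_suml.
    by apply: eq_bigr => d _; ring.
  apply: le_trans (normcD _ _) _; rewrite normc1 lerD2l.
  apply: le_trans (@sum_moebius_twist_le _ (fun=> Q) _ N0 _) _.
    move=> d _; apply: Lsum_tail; apply: leq_trans Nn; exact: leq_div.
  by rewrite sumr_const_nat subSS subn0 -[Q *+ N]mulr_natr mulfK ?lt0r_neq0.
have G_le : normc (Gsum N) <= Q.
  have := @Gsum_tail 0 N isT; rewrite /Gsum [X in _ - X]big_geq// subr0.
  by move/le_trans; apply; rewrite /glog ln1 addr0 divr1 mulr1.
have -> : mangoldt_sum chi N = Gsum N * M - 1
    - \sum_(1 <= d < N.+1) moebius_twist d * (Gsum N - Gsum (N %/ d)).
  rewrite -(mangoldt_sum_inv N0) -(Lsum_inv N0) mulr_sumr -!sumrB.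
  apply: eq_bigr => d _; have -> : Gsum (N %/ d) = Lsum chi (N %/ d) + Hsum (N %/ d).
    rewrite /Gsum /Lsum /Hsum -big_split/=; apply: eq_bigr => k _.
    by rewrite rmorphD/= rmorph1; ring.
  by ring.
apply: le_trans (normcB _ _) _; apply: lerD.
  apply: le_trans (normcB _ _) _; rewrite normc1 addrC lerD2l normcM.
  by rewrite ler_pM ?normc_ge0.
apply: le_trans (@sum_moebius_twist_le _ (fun d => Q * (2 + (ln N%:R - ln d%:R))) _ N0 _) _.
  move=> d /andP[d0 dN]; apply: le_trans (Gsum_tail _) _; first exact: leq_div.
  rewrite -mulrA ler_wpM2l ?Q_ge0// /glog ler_wpM2r ?invr_ge0//.
  have -> : 2 + (ln N%:R - ln d%:R) = 1 + (1 + ln N%:R - ln d%:R) :> R by ring.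
  rewrite lerD2l lerBrDr -lnM ?posrE ?ltr0n//.
  (* With u the integer part of N/d, d (u + 1) <= N + d <= 2 N, hence log (u + 1) <= log 2 + log
     (N/d). *)
  have ln2 : ln 2 <= 1 :> R by have := @ln_succ R 1 isT; rewrite ln1; lra.
  apply: (@le_trans _ _ (ln 2 + ln N%:R)); last by rewrite lerD2r.
  rewrite -lnM ?posrE ?ltr0n// ?ltr0Sn// -!natrM ler_lnn ?muln_gt0//.
  rewrite mulSn (leq_trans (leq_add dN (leq_divM N d)))//.
  by rewrite mul2n addnn.
rewrite ler_pdivrMr// -mulr_sumr mulrAC [leRHS]mulrC ler_wpM2l ?Q_ge0//.
rewrite big_split/= sumr_const_nat subSS subn0 -[2 *+ N]mulr_natr.
by have := @sum_ln_quot R N; lra.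
Qed.

(* Stands in for "L(1, chi) = 0 or not" without taking the limit: if the first
   bound fails at m, the tail estimate keeps every later |L_n| away from 0. *)
Lemma Lsum_dichotomy :
  (forall m, normc (Lsum chi m) <= Q / m.+1%:R) \/
  (exists K : R, forall N, (0 < N)%N -> normc (mangoldt_sum chi N) <= K).
Proof.
have [V|/existsNP[m /negP]] := pselect (forall m, normc (Lsum chi m) <= Q / m.+1%:R); first by left.
rewrite -ltNge => lt; right.
apply: (@mangoldt_sum_nonvanishing m (normc (Lsum chi m) - Q / m.+1%:R)); first by rewrite subr_gt0.
move=> n mn; have := normcB (Lsum chi n) (Lsum chi n - Lsum chi m).
rewrite subKr lerBlDr => le; apply: le_trans le _; rewrite lerD2l; exact: Lsum_tail.
Qed.

End TwistedSums.

(** * Nonvanishing for real characters *)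

Lemma abel_real (R : realType) (a f : nat -> R) (Q : R) (m n : nat) : (m <= n)%N ->
  (forall j, `|\sum_(m <= k < j) a k| <= Q) ->
  (forall k, (m <= k)%N -> f k.+1 <= f k) ->
  (forall k, (m <= k)%N -> 0 <= f k) ->
  `|\sum_(m <= k < n) a k * f k| <= Q * f m.
Proof.
move=> mn aQ f_decr f_ge0; rewrite -normc_real rmorph_sum/=.
under eq_bigr do rewrite rmorphM/=.
by apply: (abel (a := fun k => (a k)%:C)) => // j; rewrite -(rmorph_sum (real_complex R)) normc_real.
Qed.

(** * Bernoulli's inequality and finite geometric sums *)

Section Powers.
Variable R : realType.
Implicit Types (t x : R) (n d : nat).

Lemma bernoulli_ineq t n : 0 <= t <= 1 -> 1 - n%:R * (1 - t) <= t ^+ n.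
Proof.
move=> /andP[t0 t1]; elim: n => [|n IH]; first by rewrite mul0r subr0.
have := exprn_ge0 n t0; have := exprn_ile1 n t0 t1.
by rewrite exprSr [n.+1%:R]mulrSr; nra.
Qed.

Definition geom x n : R := \sum_(i < n) x ^+ i.

Lemma geomS x n : geom x n.+1 = geom x n + x ^+ n.
Proof. by rewrite /geom big_ord_recr. Qed.

Lemma geom_mul x n : (1 - x) * geom x n = 1 - x ^+ n.
Proof. by rewrite -opprB mulNr -[RHS]opprB subrX1. Qed.

Lemma geom_shift x n : geom x n.+1 = 1 + x * geom x n.
Proof.
elim: n => [|n IH]; first by rewrite /geom big_ord1 big_ord0 expr0 mulr0 addr0.
by rewrite geomS {1}IH geomS exprS; ring.
Qed.

Lemma geom_ge x n : 0 <= x <= 1 -> n%:R * x ^+ n <= geom x n.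
Proof.
move=> /andP[x0 x1]; rewrite mulr_natl -[in X in _ *+ X](card_ord n) -sumr_const.
by apply: ler_sum => i _; apply: ler_wiXn2l => //; exact: ltnW.
Qed.

Lemma geom_ge0 x n : 0 <= x -> 0 <= geom x n.
Proof. by move=> x0; rewrite sumr_ge0// => i _; rewrite exprn_ge0. Qed.

Lemma geom_gt0 x n : 0 < x -> (0 < n)%N -> 0 < geom x n.
Proof.
by move=> x0; case: n => // n _; have xW := ltW x0; rewrite geom_shift ltr_pwDl ?ltr01 ?mulr_ge0 ?geom_ge0.
Qed.

(** The inequality of arithmetic and geometric means for t, t^3, ..., t^(2n-1), whose geometric mean
    is t^n; the induction step uses Bernoulli's inequality. *)
Lemma geom_sqr_ge t n : 0 <= t <= 1 -> n%:R * t ^+ n <= t * geom (t * t) n.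
Proof.
move=> t01; have /andP[t0 t1] := t01; elim: n => [|n IH].
  by rewrite mul0r mulr_ge0// geom_ge0 ?mulr_ge0.
have := bernoulli_ineq n t01; have := exprn_ge0 n t0; have := exprn_ile1 n t0 t1.
rewrite geomS exprS [n.+1%:R]mulrSr exprMn; move: IH.
set u := t ^+ n; set g := geom _ _; set m := n%:R => IH u1 u0 B.
have m0 : 0 <= m by rewrite /m.
have : t * u * (1 - u) <= u * (m * (1 - t)).
  rewrite [t * u]mulrC -mulrA ler_wpM2l//.
  apply: (@le_trans _ _ (1 - u)); last by lra.
  by rewrite ler_piMl// subr_ge0.
by nra.
Qed.

Lemma geom_N1 n : geom (-1) n = (odd n)%:R.
Proof.
elim: n => [|n IH]; first by rewrite /geom big_ord0.
by rewrite geomS IH -signr_odd oddS; case: (odd n); rewrite /= ?expr0 ?expr1; ring.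
Qed.

Lemma nat_mul_expr_small t (eps : R) : 0 < t < 1 -> 0 < eps ->
  exists M0, forall M, (M0 <= M)%N -> M%:R * (t * t) ^+ M <= eps.
Proof.
move=> /andP[t0 t1] eps0; have t1' : 0 < 1 - t by lra.
(* Squaring M t^M (1 - t) <= 1 gives M (t t)^M <= (1 - t)^(-2) / M, which is at most eps from here
   on. *)
exists (Num.truncn ((1 - t) ^- 2 / eps)).+1 => M MM0.
have M_gt : (1 - t) ^- 2 / eps < M%:R.
  by apply: lt_le_trans (truncnS_gt _) _; rewrite ler_nat.
have u0 : 0 < t ^+ M by rewrite exprn_gt0.
have h : M%:R * t ^+ M * (1 - t) <= 1.
  have := @geom_ge t M; rewrite (ltW t0) (ltW t1) => /(_ isT).
  have := geom_mul t M; nra.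
have M0 : 0 < M%:R :> R by apply: le_lt_trans M_gt; rewrite divr_ge0 ?invr_ge0 ?exprn_ge0 ?ltW.
rewrite exprMn -(ler_pM2r M0) -(ler_pM2r t1') -(ler_pM2r t1').
move: M_gt; rewrite ltr_pdivrMr// -[X in X < _]mul1r ltr_pdivrMr ?exprn_gt0// expr2 => M_gt.
apply: (@le_trans _ _ ((M%:R * t ^+ M * (1 - t)) * (M%:R * t ^+ M * (1 - t)))).
  by rewrite le_eqVlt; apply/orP; left; apply/eqP; ring.
apply: (@le_trans _ _ 1); last by nra.
by rewrite mulr_ile1// !mulr_ge0// ltW.
Qed.

End Powers.

(** * Monsky's argument for a real character e *)

Section RealNonvanishing.
Variables (R : realType) (e : nat -> R) (Q : R).
Hypothesis e1 : e 1%N = 1.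
Hypothesis eM : forall m n, e (m * n)%N = e m * e n.
Hypothesis e_val : forall n, [\/ e n = 0, e n = 1 | e n = -1].
Hypothesis e_sum : forall m n, `|\sum_(m <= k < n) e k| <= Q.

(** The convolution 1 * e, the coefficients of zeta(s) L(s, e). *)
Definition dirichlet_conv1 n := \sum_(d <- divisors n) e d.
Local Notation r := dirichlet_conv1.

Lemma e_expn p k : e (p ^ k)%N = e p ^+ k.
Proof. by elim: k => [|k IH]; rewrite ?expn0 ?expr0// expnS eM IH exprS. Qed.

Lemma conv1_pfactor p k m : prime p -> ~~ (p %| m)%N -> (0 < m)%N ->
  r (p ^ k * m) = geom (e p) k.+1 * r m.
Proof.
move=> p_pr pNm m0; elim: k => [|k IH].
  by rewrite mul1n /geom big_ord1 expr0 mul1r.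
rewrite geomS mulrDl -IH /r big_divisors_pfactor//; congr (_ + _).
rewrite mulr_sumr; apply: eq_bigr => d _.
by rewrite eM e_expn.
Qed.

Lemma geom_e_ge0 p k : 0 <= geom (e p) k.
Proof.
have [->|->|->] := e_val p; try by rewrite geom_ge0.
by rewrite geom_N1.
Qed.

Lemma geom_e_even_ge1 p k : ~~ odd k -> 1 <= geom (e p) k.+1.
Proof.
move=> k_even; have [->|->|->] := e_val p.
- by rewrite geom_shift mul0r addr0.
- by rewrite geom_shift lerDl mul1r geom_ge0.
- by rewrite geom_N1 /= k_even.
Qed.

(** The local factor at p^k is 1 + e(p) + ... + e(p)^k, which is nonnegative for e(p) in {0, 1, -1}
    and at least 1 for even k; in a square all exponents are even. *)
Lemma conv1_ge n : (0 < n)%N -> 0 <= r n /\ (forall s, n = (s ^ 2)%N -> 1 <= r n).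
Proof.
elim/pfactor_ind => [|p k m p_pr pNm m0 [r0 r1]].
  by split=> *; rewrite /r big_seq1 e1.
rewrite conv1_pfactor//; split=> [|s sE]; first by rewrite mulr_ge0 ?geom_e_ge0.
have s0 : (0 < s)%N.
  have: (0 < p ^ k.+1 * m)%N by rewrite muln_gt0 expn_gt0 (prime_gt0 p_pr).
  by rewrite sE expn_gt0 orbF.
have [u cpu sE'] := pfactor_coprime p_pr s0.
have u0 : (0 < u)%N by move: s0; rewrite sE' muln_gt0 => /andP[].
have pNu : ~~ (p %| u)%N by rewrite -prime_coprime.
have logE : k.+1 = (logn p s).*2.
  have := congr1 (logn p) sE; rewrite lognM ?expn_gt0 ?(prime_gt0 p_pr)// pfactorK// lognX.
  by rewrite -mul2n => <-; rewrite lognE (negPf pNm) !andbF addn0.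
have mE : m = (u ^ 2)%N.
  apply/eqP; have := sE; rewrite sE' expnMn -expnM muln2 -logE mulnC => /eqP.
  by rewrite eqn_pmul2r// expn_gt0 prime_gt0.
apply: mulr_ege1; last exact: r1 mE.
by apply: geom_e_even_ge1; rewrite logE odd_double.
Qed.

Lemma sum_conv1_ge k : k%:R <= \sum_(1 <= n < (k ^ 2).+1) r n.
Proof.
elim: k => [|k IH]; first by rewrite big_geq.
rewrite (big_cat_nat (n := (k ^ 2).+1))//=; last by rewrite ltnS leq_exp2r.
rewrite [k.+1%:R]mulrSr; apply: lerD => //.
have lt : (k ^ 2 < k.+1 ^ 2)%N by rewrite ltn_exp2r.
rewrite big_nat_recr//= -[1]add0r lerD//; last by have [_] := @conv1_ge (k.+1 ^ 2) isT; apply.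
rewrite big_nat_cond sumr_ge0// => n /andP[/andP[n0 _] _].
by have [] := @conv1_ge n (leq_trans _ n0).
Qed.

Section Monsky.
Variable t : R.
Hypothesis t01 : 0 < t < 1.
(** The square root t of x is kept at hand because [geom_sqr_ge], on which the decrease of
    [lambert_gap] rests, is stated in terms of it. *)
Let x := t * t.

Let t0 : 0 < t. Proof. by case/andP: t01. Qed.
Let t1 : t < 1. Proof. by case/andP: t01. Qed.
Let x0 : 0 < x. Proof. by rewrite mulr_gt0. Qed.
Let x1 : x < 1. Proof. by rewrite mulr_ilt1// ltW. Qed.
Let x1' : 0 < 1 - x. Proof. by rewrite subr_gt0. Qed.

(* 1/(d (1 - x)) minus the Lambert term x^d/(1 - x^d) = sum_c x^(d c), as in
   Monsky's proof that L(1, chi) <> 0: it decreases in d and equals 1 at d = 1,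
   so its sum against e stays bounded as x tends to 1. *)
Definition lambert_gap d : R := (1 - x)^-1 * (d%:R^-1 - x ^+ d / geom x d).
Local Notation b := lambert_gap.

Lemma lambert_gap_ge0 d : (0 < d)%N -> 0 <= b d.
Proof.
move=> d0; rewrite /b mulr_ge0 ?invr_ge0 ?(ltW x1')// subr_ge0.
rewrite ler_pdivrMr ?geom_gt0// ler_pdivlMl ?ltr0n//.
by apply: geom_ge; rewrite !ltW.
Qed.

Lemma lambert_gap_decr d : (0 < d)%N -> b d.+1 <= b d.
Proof.
move=> d0; rewrite /b ler_wpM2l ?invr_ge0 ?(ltW x1')//.
have g0 := geom_gt0 x0 d0; have g1 := @geom_gt0 _ x d.+1 x0 isT.
have d0R : 0 < d%:R :> R by rewrite ltr0n.
have d1R : 0 < d.+1%:R :> R by rewrite ltr0n.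
have t01' : 0 <= t <= 1 by rewrite !ltW.
(* The product of [geom_sqr_ge] at d and at d + 1, with one factor t <= 1 given away. *)
have key : d%:R * d.+1%:R * x ^+ d <= geom x d * geom x d.+1.
  have h0 := geom_sqr_ge d t01'; have h1 := geom_sqr_ge d.+1 t01'.
  rewrite -(ler_pM2l x0); apply: (@le_trans _ _ ((d%:R * t ^+ d) * (d.+1%:R * t ^+ d.+1))).
    have -> : x * (d%:R * d.+1%:R * x ^+ d) = t * ((d%:R * t ^+ d) * (d.+1%:R * t ^+ d.+1)).
      by rewrite /x exprMn exprS; ring.
    by apply: ler_piMl; [rewrite !mulr_ge0 ?exprn_ge0 ?(ltW t0) | exact: ltW].
  apply: le_trans (ler_pM _ _ h0 h1) _; rewrite ?mulr_ge0 ?exprn_ge0 ?(ltW t0)//.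
  by rewrite /x le_eqVlt; apply/orP; left; apply/eqP; ring.
have -> : d%:R^-1 - x ^+ d / geom x d = d.+1%:R^-1 - x ^+ d.+1 / geom x d.+1 +
   ((d%:R * d.+1%:R)^-1 - x ^+ d / (geom x d * geom x d.+1)).
  rewrite exprS [d.+1%:R]mulrSr geom_shift; field.
  by rewrite -geom_shift -mulrSr !gt_eqF.
by rewrite lerDl subr_ge0 ler_pdivrMr ?mulr_gt0// ler_pdivlMl ?mulr_gt0//.
Qed.

Lemma lambert_term d M : (0 < d)%N ->
  \sum_(1 <= c < (M %/ d).+1) x ^+ (d * c) =
  (1 - x)^-1 * d%:R^-1 - b d - (1 - x)^-1 * (x ^+ (d * (M %/ d).+1) / geom x d).
Proof.
move=> d0; have g0 := geom_gt0 x0 d0; rewrite /b.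
set m := (M %/ d)%N.
have xd1 : (1 - x) * geom x d * (\sum_(1 <= c < m.+1) x ^+ (d * c)) =
    x ^+ d - x ^+ (d * m.+1).
  rewrite geom_mul; elim: m => [|m IH]; first by rewrite big_geq// muln1 mulr0 subrr.
  by rewrite big_nat_recr//= mulrDr IH mulrBl mul1r -exprD [in RHS]mulnS; ring.
apply: (@mulfI _ ((1 - x) * geom x d)); first by rewrite mulf_neq0 ?gt_eqF.
by rewrite xd1; field; rewrite !gt_eqF ?ltr0n.
Qed.

(** The Lambert series of e cut at d c <= M: a multiple of the partial sum of L(1, e), the sum
    against [lambert_gap], and the tails of the geometric series. *)
Lemma conv1_power_sum M :
  \sum_(1 <= n < M.+1) r n * x ^+ n =
  (1 - x)^-1 * (\sum_(1 <= d < M.+1) e d * d%:R^-1)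
  - \sum_(1 <= d < M.+1) e d * b d
  - (1 - x)^-1 * \sum_(1 <= d < M.+1) e d * (x ^+ (d * (M %/ d).+1) / geom x d).
Proof.
transitivity (\sum_(1 <= d < M.+1) \sum_(1 <= c < (M %/ d).+1) e d * x ^+ (d * c)).
  rewrite sum_dirichlet_regroup; apply: eq_big_nat => n /andP[n0 _].
  rewrite /r mulr_suml; apply: eq_big_seq => d; rewrite -dvdn_divisors// => dn.
  by rewrite mulnC divnK.
rewrite !mulr_sumr -!sumrB; apply: eq_big_nat => d /andP[d0 _].
by rewrite -mulr_sumr lambert_term//; ring.
Qed.

Lemma norm_e_le1 n : `|e n| <= 1.
Proof. by have [->|->|->] := e_val n; rewrite ?normr0 ?normrN ?normr1. Qed.

Lemma conv1_power_sum_le M :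
  \sum_(1 <= n < M.+1) r n * x ^+ n <=
  (1 - x)^-1 * `|\sum_(1 <= d < M.+1) e d * d%:R^-1| + Q
  + (1 - x)^-1 * (M%:R * x ^+ M).
Proof.
rewrite conv1_power_sum; apply: lerD; first apply: lerD.
- by rewrite ler_wpM2l ?invr_ge0 ?(ltW x1')// ler_norm.
- have -> : Q = Q * b 1%N by rewrite /b /geom big_ord1 expr0 expr1; field; rewrite gt_eqF.
  apply: le_trans (ler_norm _) _; rewrite normrN; apply: abel_real => //.
    exact: lambert_gap_decr.
  exact: lambert_gap_ge0.
(* Each of the M tails is at most x^M: its exponent exceeds M and [geom x d] is at least 1. *)
rewrite -mulrN ler_wpM2l ?invr_ge0 ?(ltW x1')//.
apply: le_trans (ler_norm _) _; rewrite normrN; apply: le_trans (ler_norm_sum _ _ _) _.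
rewrite mulr_natl -[M in _ *+ M](subn1 M.+1) -sumr_const_nat.
apply: ler_sum_nat => d /andP[d0 dM].
rewrite normrM -[leRHS]mul1r ler_pM// ?norm_e_le1//.
have g1 : 1 <= geom x d.
  by rewrite -(prednK d0) geom_shift lerDl mulr_ge0 ?geom_ge0 ?(ltW x0).
rewrite ger0_norm ?divr_ge0 ?exprn_ge0 ?geom_ge0 ?(ltW x0)//.
rewrite ler_pdivrMr ?(lt_le_trans ltr01)//.
apply: (@le_trans _ _ (x ^+ M)).
  apply: ler_wiXn2l; rewrite ?(ltW x0) ?(ltW x1)//.
  by rewrite mulnC ltnW// ltn_ceil.
by rewrite ler_peMr ?exprn_ge0 ?(ltW x0).
Qed.

Lemma conv1_power_sum_ge k M : (k ^ 2 <= M)%N ->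
  k%:R * x ^+ (k ^ 2) <= \sum_(1 <= n < M.+1) r n * x ^+ n.
Proof.
move=> kM; rewrite (big_cat_nat (n := (k ^ 2).+1))//= -[leLHS]addr0.
have rx n : (0 < n)%N -> 0 <= r n * x ^+ n.
  by move=> n0; rewrite mulr_ge0 ?exprn_ge0 ?(ltW x0)//; have [] := conv1_ge n0.
apply: lerD; last first.
  rewrite big_nat_cond sumr_ge0// => n /andP[/andP[n0 _] _].
  by rewrite rx// (leq_trans _ n0).
apply: (@le_trans _ _ ((\sum_(1 <= n < (k ^ 2).+1) r n) * x ^+ (k ^ 2))).
  by rewrite ler_wpM2r ?exprn_ge0 ?(ltW x0)// sum_conv1_ge.
rewrite mulr_suml.
apply: ler_sum_nat => n /andP[n0 nk].
rewrite ler_wpM2l//; first by have [] := conv1_ge n0.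
by apply: ler_wiXn2l; rewrite ?(ltW x0) ?(ltW x1).
Qed.

End Monsky.

(** For x = t t near 1, the squares make the sum of r(n) x^n up to M at least k x^(k^2) >= k/2,
    while decay of the partial sums of L(1, e) would keep it below 1 + Q + 1; k > 2 (Q + 2) is then
    absurd. *)
Lemma real_nonvanishing :
  ~ (forall m, `|\sum_(1 <= n < m.+1) e n * n%:R^-1| <= Q / m.+1%:R).
Proof.
move=> V; have Q0 : 0 <= Q by apply: le_trans (e_sum 0 0).
pose k := (Num.truncn (2 * (Q + 2))).+1.
have k_gt : 2 * (Q + 2) < k%:R by exact: truncnS_gt.
have k1 : 1 <= k%:R :> R by rewrite ler1n.
(* By Bernoulli, t^(2 k^2) >= 1 - 2 k^2 / (4 k^2) = 1/2. *)
pose t : R := 1 - (4 * k%:R ^+ 2)^-1.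
have y0 : 0 < (4 * k%:R ^+ 2)^-1 :> R by rewrite invr_gt0 mulr_gt0// exprn_gt0// (lt_le_trans ltr01).
have y1 : (4 * k%:R ^+ 2)^-1 < 1 :> R.
  by rewrite invf_lt1 ?mulr_gt0 ?exprn_gt0// ?(lt_le_trans ltr01)//; nra.
have t01 : 0 < t < 1 by rewrite /t subr_gt0 y1 gtrBl.
have tt1 : 0 < 1 - t * t by case/andP: t01 => t0 t1; rewrite subr_gt0 mulr_ilt1// ltW.
have tk : 2^-1 <= (t * t) ^+ (k ^ 2).
  rewrite -expr2 -exprM; apply: le_trans (bernoulli_ineq _ _).
    by rewrite /t natrM natrX le_eqVlt; apply/orP; left; apply/eqP; field; rewrite gt_eqF ?(lt_le_trans ltr01).
  by case/andP: t01 => t0 t1; rewrite !ltW.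
have [M1 M1P] := nat_mul_expr_small t01 tt1.
(* From [M1] on, M x^M <= 1 - x; from [M2] on, Q/(M + 1) <= 1 - x. Both absorb the factor 1/(1 -
   x). *)
pose M2 := (Num.truncn (Q / (1 - t * t))).+1.
pose M := maxn (k ^ 2) (maxn M1 M2).
have kM : (k ^ 2 <= M)%N by rewrite leq_maxl.
have M1M : (M1 <= M)%N by rewrite /M leq_max leq_maxl orbT.
have M2M : (M2 <= M)%N by rewrite /M !leq_max leqnn !orbT.
have := le_trans (conv1_power_sum_ge t01 kM) (conv1_power_sum_le t01 M).
have SM : (1 - t * t)^-1 * `|\sum_(1 <= d < M.+1) e d * d%:R^-1| <= 1.
  rewrite mulrC ler_pdivrMr// mul1r; apply: le_trans (V M) _.
  rewrite ler_pdivrMr ?ltr0n// -ler_pdivrMl// mulrC.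
  by apply: le_trans (ltW (truncnS_gt _)) _; rewrite ler_nat (leq_trans M2M).
have PM : (1 - t * t)^-1 * (M%:R * (t * t) ^+ M) <= 1.
  by rewrite mulrC ler_pdivrMr// mul1r M1P.
have : k%:R * 2^-1 <= k%:R * (t * t) ^+ (k ^ 2) by rewrite ler_wpM2l.
by lra.
Qed.

End RealNonvanishing.

(** * Sums of the von Mangoldt function *)

Section MangoldtSums.
Variable R : realType.
Implicit Types (N n d p k : nat).

Definition mangoldt_inv_sum N : R := \sum_(1 <= n < N.+1) mangoldt R n / n%:R.

Lemma mangoldt_div_ge0 n : 0 <= mangoldt R n / n%:R.
Proof. by rewrite divr_ge0 ?mangoldt_ge0. Qed.

(** Legendre's formula for log N!, from log = 1 * Lambda. *)
Lemma sum_ln_mangoldt N :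
  \sum_(1 <= n < N.+1) ln n%:R = \sum_(1 <= d < N.+1) mangoldt R d * (N %/ d)%:R.
Proof.
transitivity (\sum_(1 <= d < N.+1) \sum_(1 <= c < (N %/ d).+1) mangoldt R d).
  rewrite sum_dirichlet_regroup; apply: eq_big_nat => n /andP[n0 _].
  by rewrite sum_mangoldt.
by apply: eq_bigr => d _; rewrite sumr_const_nat subSS subn0 mulr_natr.
Qed.

Lemma mangoldt_inv_sum_lower N : (0 < N)%N -> ln N%:R - 1 <= mangoldt_inv_sum N.
Proof.
move=> N0; have N0R : (0 : R) < N%:R by rewrite ltr0n.
rewrite -(ler_pM2l N0R); apply: (@le_trans _ _ (\sum_(1 <= n < N.+1) ln n%:R)).
  by have := @sum_ln_ge R N; lra.
rewrite sum_ln_mangoldt mulr_sumr; apply: ler_sum_nat => d /andP[d0 _].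
rewrite mulrCA ler_wpM2l ?mangoldt_ge0// ler_pdivlMr ?ltr0n// -natrM ler_nat.
exact: leq_divM.
Qed.

(* Testing against log (3N)! rather than log N! gives the factor 3/2 without
   Chebyshev's bound; any factor below 2 is enough to exclude two vanishing
   characters. *)
Lemma mangoldt_inv_sum_upper N : (0 < N)%N -> mangoldt_inv_sum N <= 3 / 2 * (ln N%:R + ln 3).
Proof.
move=> N0; have N0R : (0 : R) < N%:R by rewrite ltr0n.
rewrite -(ler_pM2l (_ : 0 < 2 * N%:R)) ?mulr_gt0//.
apply: (@le_trans _ _ (\sum_(1 <= n < (3 * N).+1) ln n%:R)); last first.
  have -> : 2 * N%:R * (3 / 2 * (ln N%:R + ln 3)) = (3 * N)%:R * ln (3 * N)%:R :> R.
    by rewrite natrM lnM ?posrE//; field.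
  rewrite mulr_natl -[X in _ *+ X](subn1 (3 * N).+1) -sumr_const_nat.
  by apply: ler_sum_nat => n /andP[n0 nN]; rewrite ler_lnn.
rewrite sum_ln_mangoldt mulr_sumr [leRHS](big_cat_nat (n := N.+1))//=; last by lia.
rewrite -[leLHS]addr0 lerD//; last by rewrite sumr_ge0// => d _; rewrite mulr_ge0 ?mangoldt_ge0.
apply: ler_sum_nat => d /andP[d0 dN].
rewrite mulrCA ler_wpM2l ?mangoldt_ge0// ler_pdivrMr ?ltr0n// -!natrM ler_nat.
(* For d <= N and u the integer part of 3N/d, d u > 3N - d >= 2N. *)
have := ltn_ceil (3 * N) d0; move: dN; set u := (_ %/ _)%N; nia.
Qed.

Lemma ler_sum_term (F : nat -> R) m n i : (m <= i < n)%N ->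
  (forall j, 0 <= F j) -> F i <= \sum_(m <= j < n) F j.
Proof.
move=> imn F0; rewrite (bigD1_seq i) ?mem_index_iota ?iota_uniq//=.
by rewrite lerDl sumr_ge0.
Qed.

Lemma mangoldt_nonprime_le n N : (0 < n <= N)%N -> ~~ prime n ->
  mangoldt R n / n%:R <= \sum_(2 <= p < N.+1) \sum_(2 <= k < N.+1)
     (if n == (p ^ k)%N then ln p%:R / p%:R ^+ k else 0).
Proof.
move=> /andP[n0 nN] nPn.
have F0 p k : 0 <= (if n == (p ^ k)%N then ln p%:R / p%:R ^+ k else 0) :> R.
  by case: ifP => // _; rewrite divr_ge0 ?lnn_ge0// exprn_ge0.
rewrite /mangoldt; case: ifP => [/andP[n1 nat_n]|_]; last first.
  by rewrite mul0r sumr_ge0// => p _; rewrite sumr_ge0.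
have p_pr := pdiv_prime n1; set p := pdiv n in nat_n p_pr *.
have nE : n = (p ^ logn p n)%N by rewrite -p_part part_pnat_id.
have pn : (p <= n)%N by rewrite pdiv_leq.
have k2 : (2 <= logn p n)%N.
  rewrite ltnNge; apply/negP => k1; move: nE n1 nPn; rewrite -/p.
  by case: (logn p n) k1 => [|[|//]] _ ->; rewrite ?expn1 ?p_pr.
have kN : (logn p n < N.+1)%N by rewrite ltnS (leq_trans _ nN)// ltnW// ltn_logl.
apply: le_trans (ler_sum_term (i := p) _ _) => [||j]; last by rewrite sumr_ge0.
  apply: le_trans (ler_sum_term (i := logn p n) _ _) => //; last by rewrite k2.
  by rewrite -nE eqxx -natrX -nE.
by rewrite prime_gt1//= ltnS (leq_trans pn).
Qed.

Lemma sum_inv_pow_le (x : R) N : 1 < x ->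
  \sum_(2 <= k < N.+1) x ^- k <= (x * (x - 1))^-1.
Proof.
move=> x1; have x1' : 0 < x - 1 by rewrite subr_gt0.
have x0 : 0 < x by apply: lt_trans x1.
(* The exact value, with the tail of the series; [maxn 1 N] covers the empty sum at N = 0. *)
suff : \sum_(2 <= k < N.+1) x ^- k <= (x * (x - 1))^-1 - (x - 1)^-1 * x ^- (maxn 1 N).
  move/le_trans; apply; rewrite gerBl mulr_ge0 ?invr_ge0 ?exprn_ge0 ?ltW//.
elim: N => [|[|N] IH]; try by rewrite big_geq//= expr1 invfM mulrC subrr.
rewrite big_nat_recr//=; apply: le_trans (lerD IH (lexx _)) _.
rewrite !(maxn_idPr _)// le_eqVlt; apply/orP; left; apply/eqP.
by rewrite [x ^+ N.+2]exprS; field; rewrite !gt_eqF ?exprn_gt0.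
Qed.

Lemma sum_ln_inv_le N : \sum_(2 <= p < N.+1) ln p%:R / (p%:R * (p%:R - 1)) <= 2 :> R.
Proof.
(* The subtracted (2 + log n)/n dominates what remains beyond n; its 2 absorbs (n + 1)(log (n + 1) -
   log n) <= 2 in the induction. *)
suff : \sum_(2 <= p < N.+1) ln p%:R / (p%:R * (p%:R - 1)) <=
    2 - (2 + ln (maxn 1 N)%:R) / (maxn 1 N)%:R :> R.
  by move/le_trans; apply; rewrite gerBl divr_ge0// addr_ge0 ?lnn_ge0.
elim: N => [|[|N] IH]; try by rewrite big_geq//= ln1 addr0 divr1 subrr.
rewrite big_nat_recr//=; apply: le_trans (lerD IH (lexx _)) _.
rewrite !(maxn_idPr _)// -lerBrDl.
have n0 : 0 < N.+1%:R :> R by rewrite ltr0n.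
have := @ln_succ R N.+1 isT; have n1 : 1 <= N.+1%:R :> R by rewrite ler1n.
rewrite [N.+2%:R in X in X -> _]mulrSr.
rewrite ![N.+2%:R]mulrSr addrK.
move: (ln (N.+1%:R + 1)) (ln N.+1%:R) => u v; move: N.+1%:R n0 n1 => m n0 n1 h.
have -> : 2 - (2 + u) / (m + 1) - (2 - (2 + v) / m) =
   (2 + u - ((m + 1) * (u - v))) / ((m + 1) * m).
  by field; rewrite !gt_eqF//; lra.
apply: ler_wpM2r; first by rewrite invr_ge0 mulr_ge0//; lra.
have uv : u - v <= 1 by rewrite leNgt; apply/negP; nra.
by lra.
Qed.

(** Only the powers p^k with k >= 2 matter, and p may run over all integers from 2 on: the series in
    k sums to 1/(p (p - 1)). *)
Lemma sum_mangoldt_nonprime_le N : \sum_(1 <= n < N.+1 | ~~ prime n) mangoldt R n / n%:R <= 2.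
Proof.
apply: le_trans (sum_ln_inv_le N).
pose F n p k : R := if n == (p ^ k)%N then ln p%:R / p%:R ^+ k else 0.
apply: (@le_trans _ _ (\sum_(1 <= n < N.+1) \sum_(2 <= p < N.+1) \sum_(2 <= k < N.+1) F n p k)).
  rewrite big_mkcond; apply: ler_sum_nat => n /andP[n0 nN].
  case: ifP => nPn; first by apply: mangoldt_nonprime_le => //; rewrite n0.
  rewrite sumr_ge0// => p _; rewrite sumr_ge0// => k _.
  by rewrite /F; case: ifP => // _; rewrite divr_ge0 ?lnn_ge0// exprn_ge0.
rewrite exchange_big/=; apply: ler_sum_nat => p /andP[p2 _].
rewrite exchange_big/=.
apply: (@le_trans _ _ (\sum_(2 <= k < N.+1) ln p%:R * p%:R ^- k)).
  apply: ler_sum_nat => k _; rewrite /F -big_mkcond/= big_const_seq.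
  have c1 : (count (fun n => n == (p ^ k)%N) (index_iota 1 N.+1) <= 1)%N.
    by rewrite (count_uniq_mem _ (iota_uniq _ _)) leq_b1.
  case: (count _ _) c1 => [_|[_|//]] /=; rewrite ?addr0//.
  by rewrite mulr_ge0 ?lnn_ge0 ?invr_ge0 ?exprn_ge0.
by rewrite -mulr_sumr ler_wpM2l ?lnn_ge0// sum_inv_pow_le// ltr1n.
Qed.

(** Serves both for a residue class whose primes stop at B and for the n not coprime to q, whose
    primes divide q. *)
Lemma sum_mangoldt_pred_le (P : pred nat) B : (forall p, prime p -> P p -> (p <= B)%N) ->
  forall N, \sum_(1 <= n < N.+1 | P n) mangoldt R n / n%:R <= mangoldt_inv_sum B + 2.
Proof.
move=> PB N; rewrite (bigID prime)/= lerD//; last first.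
  apply: le_trans (sum_mangoldt_nonprime_le N).
  rewrite big_mkcond [leRHS]big_mkcond; apply: ler_sum => n _.
  by case: (P n) => //=; case: ifP => // _; rewrite mangoldt_div_ge0.
have [NB|BN] := leqP N B.
  rewrite /mangoldt_inv_sum [leRHS](big_cat_nat (n := N.+1))//= -[leLHS]addr0 lerD//; last first.
    by rewrite sumr_ge0// => n _; rewrite mangoldt_div_ge0.
  rewrite big_mkcond; apply: ler_sum => n _.
  by case: ifP => // _; rewrite mangoldt_div_ge0.
rewrite [leLHS](big_cat_nat (n := B.+1))//=; last exact: ltnW.
rewrite [X in _ + X]big_nat_cond [X in _ + X]big1 ?addr0; last first.
  move=> n /andP[/andP[Bn _] /andP[Pn n_pr]].
  by have := PB n n_pr Pn; rewrite leqNgt Bn.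
rewrite big_mkcond; apply: ler_sum => n _.
by case: ifP => // _; rewrite mangoldt_div_ge0.
Qed.

End MangoldtSums.

(** * Dirichlet characters *)

Lemma prim_root_exists (F : numClosedFieldType) n : (0 < n)%N ->
  exists z : F, n.-primitive_root z.
Proof.
pose p : {poly F} := 'X^n - 1; have [r Dp] := closed_field_poly_normal p.
move=> n_gt0; rewrite (monicP _) ?monicXnsubC // scale1r in Dp.
have rn1 : all n.-unity_root r by apply/allP=> z; rewrite -root_prod_XsubC -Dp.
have sz_r : (n < (size r).+1)%N.
  by rewrite -(size_prod_XsubC r id) -Dp size_XnsubC.
have [|z] := hasP (has_prim_root n_gt0 rn1 _ sz_r); last by exists z.
by rewrite -separable_prod_XsubC -Dp separable_Xn_sub_1 // pnatr_eq0 -lt0n.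
Qed.

(** * Characters of a finite abelian group and their orthogonality *)

Section AdditiveCharacters.
Variable gT : finGroupType.
Hypothesis gT_abelian : abelian [set: gT].
Variable n : nat.
Hypothesis card_gT : #|gT| = n.+1.

(* A character is coded by its exponents, f being x |-> w ^+ f x for a fixed
   primitive root of unity w, so that characters form a finite additive group. *)
Definition is_char (f : {ffun gT -> 'I_n.+1}) : bool :=
  [forall x, forall y, f (x * y)%g == f x + f y].

Implicit Types f : {ffun gT -> 'I_n.+1}.

Lemma is_charP f : reflect (forall x y, f (x * y)%g = f x + f y) (is_char f).
Proof.
apply: (iffP forallP) => [h x y|h x]; first by have /forallP/(_ y)/eqP := h x.
by apply/forallP => y; rewrite h.
Qed.

Lemma is_char0 : is_char 0.
Proof. by apply/is_charP => x y; rewrite !ffunE addr0. Qed.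

Lemma is_charD f g : is_char f -> is_char g -> is_char (f + g).
Proof.
by move=> /is_charP hf /is_charP hg; apply/is_charP => x y; rewrite !ffunE hf hg addrACA.
Qed.

Lemma is_charN f : is_char f -> is_char (- f).
Proof. by move=> /is_charP hf; apply/is_charP => x y; rewrite !ffunE hf opprD. Qed.

Lemma is_char1 f : is_char f -> f 1%g = 0.
Proof.
move=> /is_charP hf; have := hf 1%g 1%g.
by rewrite mulg1 => /esym/eqP; rewrite addrC -subr_eq0 addrK => /eqP.
Qed.

Lemma expgn_card (x : gT) : (x ^+ n.+1 = 1)%g.
Proof. by rewrite -card_gT -cardsT expg_cardG ?inE. Qed.

(* Characters into algC already separate points; a root of unity of algC and one
   of R[i] have the same exponents. *)
Lemma char_separates (g : gT) : g != 1%g -> exists2 f, is_char f & f g != 0.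
Proof.
move=> g1; pose G := [set: gT]%G.
have [i gNker] : exists i : Iirr G, g \notin cfker 'chi_i.
  apply/existsP; rewrite -negb_forall; apply: contra g1 => /forallP h.
  apply/eqP/set1gP; rewrite -(TI_cfker_irr G); apply/bigcapP => i _; exact: h.
have lin_i : 'chi_i \is a linear_char by move/char_abelianP: gT_abelian => /(_ i).
have [z z_prim] := prim_root_exists algC (ltn0Sn n).
have zchi x : {k : 'I_n.+1 | 'chi_i x = z ^+ k}.
  apply: prim_rootP => //.
  by rewrite -lin_charX ?inE// expgn_card lin_char1.
pose f := [ffun x => sval (zchi x)].
have fE x : z ^+ f x = 'chi_i x by rewrite ffunE; case: (zchi x).
exists f.
  apply/is_charP => x y; apply/val_inj => /=; apply/eqP.
  rewrite -(modn_small (ltn_ord (f (x * y)%g))) -(eq_prim_root_expr z_prim).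
  by rewrite exprD !fE lin_charM ?inE.
apply: contra gNker => /eqP fg0.
by rewrite cfkerEirr inE -(fE g) fg0 expr0 lin_char1.
Qed.

Variables (F : fieldType) (w : F).
Hypothesis w_prim : n.+1.-primitive_root w.

Lemma char_exprD (i j : 'I_n.+1) : w ^+ (i + j)%R = w ^+ i * w ^+ j.
Proof. by rewrite /= prim_expr_mod// exprD. Qed.

Lemma char_expr_eq1 (i : 'I_n.+1) : (w ^+ i == 1) = (i == 0).
Proof.
rewrite -(expr0 w) (eq_prim_root_expr w_prim) !modn_small ?ltn_ord//.
Qed.

(** Translation by y with f y <> 0 permutes the terms and multiplies the sum by w^(f y) <> 1. *)
Lemma sum_char_group f : is_char f -> f != 0 -> \sum_x w ^+ f x = 0.
Proof.
move=> /is_charP hf f0; have [y fy] : exists y, f y != 0.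
  apply/existsP; rewrite -negb_forall; apply: contra f0 => /forallP h.
  by apply/eqP/ffunP => x; rewrite ffunE; apply/eqP.
apply/eqP; have : (1 - w ^+ f y) * (\sum_x w ^+ f x) == 0.
  rewrite mulrBl mul1r subr_eq0 mulr_sumr (reindex_inj (mulgI y))/=.
  by apply/eqP; apply: eq_bigr => x _; rewrite hf char_exprD.
by rewrite mulf_eq0 subr_eq0 eq_sym char_expr_eq1 (negPf fy).
Qed.

(** The dual argument: translate the characters by one that separates g from 1. *)
Lemma sum_group_char g : g != 1%g -> \sum_(f | is_char f) w ^+ f g = 0.
Proof.
move=> /char_separates[h hh hg].
apply/eqP; have : (1 - w ^+ h g) * (\sum_(f | is_char f) w ^+ f g) == 0.
  rewrite mulrBl mul1r subr_eq0 mulr_sumr (reindex_inj (addrI h))/=; apply/eqP.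
  apply: eq_big => [f|f _]; last by rewrite ffunE char_exprD.
  apply/idP/idP => [hf|]; last exact: is_charD.
  by rewrite -[f](addKr h); apply: is_charD => //; apply: is_charN.
by rewrite mulf_eq0 subr_eq0 eq_sym char_expr_eq1 (negPf hg).
Qed.

End AdditiveCharacters.

(** * Characters modulo q as functions on the natural numbers *)

Section DirichletCharacters.
Variables (R : realType) (q' : nat).
(* 'Z_q is the ring of integers modulo q only when q >= 2. *)
Local Notation q := q'.+2.
Local Notation U := {unit 'Z_q}.

Let n := #|{: U}|.-1.
Let card_U : #|{: U}| = n.+1.
Proof. by apply/esym/prednK; rewrite (cardD1 1%g). Qed.

Let U_abelian : abelian [set: U].
Proof. exact: units_Zp_abelian. Qed.

(** Defaults to 1 when k is not coprime to q; [dirichlet_char] tests coprimality first. *)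
Definition residue (k : nat) : U := insubd (1%g : U) (k%:R : 'Z_q).

Lemma val_residue k : coprime q k -> val (residue k) = k%:R.
Proof. by move=> cqk; rewrite /residue insubdK// unitZpE. Qed.

Lemma residueM k l : coprime q k -> coprime q l ->
  residue (k * l) = (residue k * residue l)%g.
Proof.
move=> ck cl; apply: val_inj; rewrite val_residue ?coprimeMr ?ck//.
by rewrite /= !val_residue// natrM.
Qed.

Lemma eq_residue k l : coprime q k -> coprime q l ->
  (residue k == residue l) = (k == l %[mod q])%N.
Proof.
move=> ck cl; rewrite -val_eqE !val_residue//.
by rewrite -(inj_eq val_inj)/= !val_Zp_nat.
Qed.

Variable w : R[i].
Hypothesis w_prim : n.+1.-primitive_root w.

Local Notation idx := {ffun U -> 'I_n.+1}.
Implicit Types f g : idx.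

Definition dirichlet_char f k : R[i] :=
  if coprime q k then w ^+ f (residue k) else 0.
Local Notation chi := dirichlet_char.

Lemma normc_prim (k : nat) : normc (w ^+ k) = 1.
Proof.
have nX (z : R[i]) j : normc (z ^+ j) = normc z ^+ j.
  by elim: j => [|j IH]; rewrite ?expr0 ?normc1// !exprS normcM IH.
have : normc w ^+ n.+1 == 1 by rewrite -nX (prim_expr_order w_prim) normc1.
by rewrite pexpr_eq1// ?normc_ge0// => /eqP w1; rewrite nX w1 expr1n.
Qed.

Lemma dirichlet_char1 f : is_char f -> chi f 1%N = 1.
Proof.
move=> hf; rewrite /chi coprimen1.
have -> : residue 1 = 1%g by apply: val_inj; rewrite val_residue ?coprimen1.
by rewrite is_char1.
Qed.

Lemma dirichlet_charM f : is_char f ->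
  forall k l, chi f (k * l)%N = chi f k * chi f l.
Proof.
move=> /is_charP hf k l; rewrite /chi coprimeMr.
have [ck|] := boolP (coprime q k); last by rewrite mul0r.
have [cl|] := boolP (coprime q l); last by rewrite mulr0.
by rewrite residueM// hf (char_exprD w_prim).
Qed.

Lemma dirichlet_char_le1 f k : normc (chi f k) <= 1.
Proof. by rewrite /chi; case: ifP; rewrite ?normc_prim ?normc0. Qed.

Lemma dirichlet_char_periodic f k : chi f (k + q) = chi f k.
Proof.
rewrite /chi /coprime gcdnDr; case: eqP => // ck.
congr (w ^+ f _); apply/eqP; rewrite eq_residue ?modnDr//; apply/eqP => //.
by rewrite gcdnDr.
Qed.

Lemma dirichlet_char_sum_period f : is_char f -> f != 0 ->
  \sum_(0 <= k < q) chi f k = 0.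
Proof.
move=> hf f0; rewrite -[RHS](sum_char_group w_prim hf f0) big_mkord.
rewrite /dirichlet_char -big_mkcond/= (reindex_onto (val : U -> 'Z_q) (insubd (1%g : U)))/=; last first.
  by move=> k ck; rewrite insubdK.
apply: eq_big => [x|x _].
  rewrite -unitZpE// natr_Zp (valP x)/=; apply/eqP; apply: val_inj.
  by rewrite insubdK ?(valP x).
congr (w ^+ f _); apply: val_inj; rewrite val_residue ?natr_Zp//.
by rewrite -unitZpE// natr_Zp (valP x).
Qed.

(** Full periods sum to 0, so a sum from 0 reduces to fewer than q terms of modulus at most 1; an
    interval is a difference of two such sums. *)
Lemma dirichlet_char_sum f : is_char f -> f != 0 ->
  forall j k, normc (\sum_(j <= i < k) chi f i) <= (2 * q)%:R.
Proof.
move=> hf f0.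
have window j : \sum_(j <= i < j + q) chi f i = 0.
  elim: j => [|j IH]; first exact: dirichlet_char_sum_period.
  have lt : (j < j + q)%N by rewrite -[X in (X < _)%N]addn0 ltn_add2l.
  by rewrite addSn big_nat_recr//= dirichlet_char_periodic addrC -big_ltn.
pose A k := \sum_(0 <= i < k) chi f i.
have A_mod k : A k = A (k %% q)%N.
  rewrite {1}(divn_eq k q); elim: (k %/ q)%N => [|m IH]; first by rewrite mul0n.
  rewrite -IH mulSn -addnA addnC /A (big_cat_nat (n := (m * q + k %% q)%N)) ?leq_addr//=.
  by rewrite window addr0.
have A_le k : normc (A k) <= q%:R.
  rewrite A_mod; apply: le_trans (normc_sum _ _ _) _.
  apply: (@le_trans _ _ (\sum_(0 <= i < k %% q) 1)).
    by apply: ler_sum => i _; exact: dirichlet_char_le1.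
  by rewrite sumr_const_nat subn0 ler_nat ltnW// ltn_mod.
move=> j k; have [kj|jk] := leqP k j; first by rewrite big_geq// normc0 ler0n.
have -> : \sum_(j <= i < k) chi f i = A k - A j.
  rewrite /A (big_cat_nat (m := 0%N) (n := j) _ (ltnW jk))//=.
  by rewrite [X in _ = X - _]addrC addrK.
by apply: le_trans (normcB _ _) _; rewrite mul2n -addnn natrD lerD.
Qed.

Lemma dirichlet_char_vanish f k : ~~ coprime q k -> chi f k = 0.
Proof. by rewrite /chi => /negPf->. Qed.

Lemma dirichlet_char0 k : chi 0 k = (coprime q k)%:R.
Proof. by rewrite /chi ffunE expr0; case: ifP. Qed.

Lemma dirichlet_orthogonality k l : coprime q l ->
  \sum_(f | is_char f) w ^+ f (residue l)^-1%g * chi f k =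
  if (k == l %[mod q])%N then #|[pred f : idx | is_char f]|%:R else 0.
Proof.
move=> cl; have cE : (k == l %[mod q])%N -> coprime q k.
  by move=> /eqP kl; rewrite -coprime_modr kl coprime_modr.
have [ck|nck] := boolP (coprime q k); last first.
  rewrite big1; first by case: ifP => // /cE; rewrite (negPf nck).
  by move=> f _; rewrite dirichlet_char_vanish// mulr0.
transitivity (\sum_(f : idx | is_char f) w ^+ f ((residue l)^-1 * residue k)%g).
  by apply: eq_bigr => f /is_charP hf; rewrite /chi ck hf (char_exprD w_prim).
case: ifPn => [kl|nkl].
  move: kl; rewrite -eq_residue// => /eqP->; rewrite mulVg.
  rewrite -sum1_card natr_sum; apply: eq_bigr => f hf.
  by rewrite (is_char1 hf) expr0.
apply: (sum_group_char U_abelian card_U w_prim).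
by rewrite -eq_mulVg1 eq_sym eq_residue.
Qed.

(** Nonzero values lie on the unit circle, where the conjugate is the inverse. *)
Lemma dirichlet_charN f k : is_char f -> chi (- f) k = (chi f k)^*.
Proof.
move=> hf; rewrite /chi; case: ifP => _; last by rewrite rmorph0.
set i := f _; have w0 : w ^+ i != 0.
  by rewrite expf_neq0// -normr_gt0 -[`|w|]/((normc w)%:C) -[w]expr1 normc_prim ltcR.
apply: (mulfI w0); rewrite -sqr_normc -[`|_|]/((normc _)%:C) normc_prim expr1n ffunE.
by rewrite -(char_exprD w_prim) subrr expr0.
Qed.

End DirichletCharacters.

(** * Primes in arithmetic progressions *)

Lemma ln_nat_unbounded (R : realType) (K : R) : exists2 N : nat, (0 < N)%N & (K < ln N%:R)%R.
Proof.
exists (Num.truncn (expR K)).+1 => //.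
by rewrite -[X in X < _]expRK ltr_ln ?posrE ?expR_gt0 ?ltr0n// truncnS_gt.
Qed.

Lemma sum_bounded (R : realType) (I : finType) (P : pred I) (F : I -> nat -> R) :
  (forall i, P i -> exists K, forall N, (0 < N)%N -> F i N <= K) ->
  exists K, forall N, (0 < N)%N -> \sum_(i | P i) F i N <= K.
Proof.
move=> FK; have [K KP] : exists K : I -> R, forall i, P i -> forall N, (0 < N)%N -> F i N <= K i.
  apply: (@fin_all_exists I (fun=> R) (fun i K => P i -> forall N, (0 < N)%N -> F i N <= K)) => i.
  have [/FK[K KP]|nPi] := boolP (P i); first by exists K.
  by exists 0.
by exists (\sum_(i | P i) K i) => N N0; apply: ler_sum => i Pi; apply: KP.
Qed.

Section Dirichlet.
Variables (R : realType) (q' : nat).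
Local Notation q := q'.+2.
Local Notation U := {unit 'Z_q}.
Local Notation n := #|{: U}|.-1.
Variable w : R[i].
Hypothesis w_prim : n.+1.-primitive_root w.

Local Notation idx := {ffun U -> 'I_n.+1}.
Implicit Types f g : idx.
Local Notation chi := (@dirichlet_char R q' w).
Local Notation Q := ((2 * q)%:R : R).

Lemma sum_char_mangoldt_sum l N : coprime q l ->
  \sum_(f : idx | is_char f) w ^+ f (residue q' l)^-1%g * mangoldt_sum (chi f) N =
  (#|[pred f : idx | is_char f]|%:R *
   \sum_(1 <= k < N.+1 | k == l %[mod q]) mangoldt R k / k%:R)%:C.
Proof.
move=> cl; under eq_bigr do rewrite mulr_sumr.
rewrite exchange_big/= mulr_sumr rmorph_sum/= [RHS]big_mkcond/=.
apply: eq_bigr => k _.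
transitivity ((\sum_(f : idx | is_char f) w ^+ f (residue q' l)^-1%g * chi f k) *
   (mangoldt R k / k%:R)%:C).
  rewrite mulr_suml; apply: eq_bigr => f _.
  by rewrite /twist rmorphM/= [X in _ = _ * X]mulrC !mulrA.
rewrite (dirichlet_orthogonality w_prim)//; case: ifP => _; last by rewrite mul0r.
by rewrite [in RHS]rmorphM/= rmorph_nat.
Qed.

Lemma mangoldt_sum_char0 N :
  mangoldt_sum (chi 0) N = (\sum_(1 <= k < N.+1 | coprime q k) mangoldt R k / k%:R)%:C.
Proof.
rewrite /mangoldt_sum rmorph_sum/= [RHS]big_mkcond/=; apply: eq_bigr => k _.
rewrite /twist dirichlet_char0; case: ifP => _; last by rewrite !mul0r.
by rewrite mul1r mulrC -rmorphM.
Qed.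

(** Orthogonality at l = 1 makes the sum a multiple of a sum of terms Lambda(n)/n. *)
Lemma Re_sum_mangoldt_sum_ge0 N :
  0 <= \sum_(f : idx | is_char f) complex.Re (mangoldt_sum (chi f) N).
Proof.
have := sum_char_mangoldt_sum N (coprimen1 q).
have -> : (residue q' 1)^-1%g = 1%g.
  by apply/eqP; rewrite invg_eq1; apply/eqP/val_inj; rewrite val_residue ?coprimen1.
move=> E; suff -> : \sum_(f : idx | is_char f) complex.Re (mangoldt_sum (chi f) N) =
   #|[pred f : idx | is_char f]|%:R *
   \sum_(1 <= k < N.+1 | k == 1%N %[mod q]) mangoldt R k / k%:R.
  by rewrite mulr_ge0// sumr_ge0// => k _; rewrite mangoldt_div_ge0.
rewrite -[RHS]/(complex.Re (_%:C)) -E.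
rewrite (raddf_sum (@complex.Re R : {additive R[i] -> R})).
by apply: eq_bigr => f hf; rewrite is_char1// expr0 mul1r.
Qed.

(** For nonprincipal chi a finite form of L(1, chi) = 0: the bound forces the limit 0 and, by
    [Lsum_tail], follows from it. *)
Definition vanishing f := forall m, normc (Lsum (chi f) m) <= Q / m.+1%:R.

Lemma vanishing_Re f N : is_char f -> f != 0 -> vanishing f -> (0 < N)%N ->
  complex.Re (mangoldt_sum (chi f) N) <= Q - ln N%:R.
Proof.
move=> hf f0 V N0.
have := mangoldt_sum_vanishing (dirichlet_char1 w hf) (dirichlet_charM w_prim hf)
  (dirichlet_char_le1 w_prim f) (dirichlet_char_sum w_prim hf f0) V N0.
move/(le_trans (Re_le_normc _)); rewrite lerBrDl.
by case: (mangoldt_sum _ _).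
Qed.

Lemma vanishing_or_bounded f : is_char f -> f != 0 ->
  vanishing f \/ exists K : R, forall N, (0 < N)%N -> normc (mangoldt_sum (chi f) N) <= K.
Proof.
move=> hf f0; exact: (Lsum_dichotomy (dirichlet_char1 w hf) (dirichlet_charM w_prim hf)
  (dirichlet_char_le1 w_prim f) (dirichlet_char_sum w_prim hf f0)).
Qed.

Lemma Re_mangoldt_sum_bounded f : is_char f -> f != 0 ->
  exists K : R, forall N, (0 < N)%N -> complex.Re (mangoldt_sum (chi f) N) <= K.
Proof.
move=> hf f0; have [V|[K KP]] := vanishing_or_bounded hf f0.
  exists Q => N N0; apply: le_trans (vanishing_Re hf f0 V N0) _.
  by rewrite gerBl lnn_ge0.
by exists K => N N0; apply: le_trans (Re_le_normc _) (KP _ N0).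
Qed.

Lemma vanishing_opp f : is_char f -> vanishing f -> vanishing (- f).
Proof.
move=> hf V m; suff -> : Lsum (chi (- f)) m = (Lsum (chi f) m)^*.
  suff -> : normc (Lsum (chi f) m)^* = normc (Lsum (chi f) m) by exact: V.
  by case: (Lsum _ _) => a b; rewrite /= sqrrN.
rewrite /Lsum rmorph_sum/=; apply: eq_bigr => k _.
by rewrite /twist (dirichlet_charN w_prim)// rmorphM/= oppr0.
Qed.

(** -f = f says that chi is its own conjugate, so its values are 0, 1 and -1 and [real_nonvanishing]
    applies. *)
Lemma real_char_not_vanishing f : is_char f -> f != 0 -> - f = f -> ~ vanishing f.
Proof.
move=> hf f0 fN V; pose e k := complex.Re (chi f k).
have eE k : chi f k = (e k)%:C.
  have := dirichlet_charN w_prim k hf; rewrite fN /e.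
  by case: (chi f k) => a b [] /eqP; rewrite -addr_eq0 -mulr2n mulrn_eq0/= => /eqP->.
have eC k : `|e k| = normc (chi f k) by rewrite eE normc_real.
apply: (@real_nonvanishing R e Q).
- by apply: complexI; rewrite -eE dirichlet_char1.
- by move=> j k; apply: complexI; rewrite rmorphM/= -!eE (dirichlet_charM w_prim).
- move=> k; have [/eqP cqk|nc] := boolP (coprime q k); last first.
    by apply: Or31; apply: complexI; rewrite -eE dirichlet_char_vanish.
  have : `|e k| = 1.
    by rewrite eC /dirichlet_char /coprime cqk eqxx (normc_prim w_prim).
  by move/eqP; rewrite eqr_norml ler01 andbT => /orP[]/eqP->; [apply: Or32|apply: Or33].
- move=> j k; rewrite -normc_real rmorph_sum/=.
  by under eq_bigr do rewrite -eE; exact: (dirichlet_char_sum w_prim).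
move=> m; suff <- : normc (Lsum (chi f) m) = `|\sum_(1 <= k < m.+1) e k / k%:R| by exact: V.
rewrite -normc_real rmorph_sum/=; congr normc; apply: eq_bigr => k _.
by rewrite /twist eE rmorphM.
Qed.

(* If chi is not real, its conjugate vanishes too, and the sum over all characters
   of Re T(chi, N) is at most (3/2 - 2) log N + O(1), yet it is nonnegative. *)
Lemma char_not_vanishing f : is_char f -> f != 0 -> ~ vanishing f.
Proof.
move=> hf f0 V; have [fN|fN] := eqVneq (- f) f.
  exact: (real_char_not_vanishing hf f0 fN V).
have f0' : - f != 0 by rewrite oppr_eq0.
have hf' := is_charN hf; have V' := vanishing_opp hf V.
have [|K KP] := @sum_bounded R idx [pred g | [&& is_char g, g != 0, g != f & g != - f]]
   (fun g N => complex.Re (mangoldt_sum (chi g) N)).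
  by move=> g /and4P[hg g0 _ _]; apply: Re_mangoldt_sum_bounded.
(* The coefficient of log N is 3/2 - 2 = -1/2, whence the factor 2. *)
have [N N0] := ln_nat_unbounded (2 * (3 / 2 * ln 3 + 2 * Q + K)).
have := Re_sum_mangoldt_sum_ge0 N.
rewrite (bigD1 (0 : idx)) ?is_char0//= (bigD1 f) ?hf//= (bigD1 (- f)) ?hf' ?f0'//=.
have -> : \sum_(g | is_char g && (g != 0) && (g != f) && (g != - f))
    complex.Re (mangoldt_sum (chi g) N) =
  \sum_(g | [pred g | [&& is_char g, g != 0, g != f & g != - f]] g)
    complex.Re (mangoldt_sum (chi g) N).
  by apply: eq_bigl => g /=; rewrite !andbA.
have := KP N N0; have := vanishing_Re hf f0 V N0; have := vanishing_Re hf' f0' V' N0.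
have : complex.Re (mangoldt_sum (chi 0) N) <= 3 / 2 * (ln N%:R + ln 3).
  apply: le_trans (mangoldt_inv_sum_upper R N0); rewrite mangoldt_sum_char0/= big_mkcond.
  by apply: ler_sum => k _; case: ifP => // _; rewrite mangoldt_div_ge0.
by lra.
Qed.

Lemma primes_mod_unbounded l B : coprime q l ->
  exists2 p, prime p & (B < p)%N && (p == l %[mod q]).
Proof.
move=> cl; have [[p p_pr pB]|noP] := pselect (exists2 p, prime p & (B < p)%N && (p == l %[mod q])).
  by exists p.
exfalso.
have W_le N : \sum_(1 <= k < N.+1 | k == l %[mod q]) mangoldt R k / k%:R <= mangoldt_inv_sum R B + 2.
  apply: sum_mangoldt_pred_le => p p_pr pl; rewrite leqNgt; apply/negP => Bp.
  by apply: noP; exists p => //; rewrite Bp.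
have nc_le N : \sum_(1 <= k < N.+1 | ~~ coprime q k) mangoldt R k / k%:R <= mangoldt_inv_sum R q + 2.
  apply: sum_mangoldt_pred_le => p p_pr; rewrite coprime_sym prime_coprime// negbK.
  exact: dvdn_leq.
have [|K KP] := @sum_bounded R idx [pred f | is_char f && (f != 0)]
   (fun f N => normc (w ^+ f (residue q' l)^-1%g * mangoldt_sum (chi f) N)).
  move=> f /andP[hf f0]; have [/(char_not_vanishing hf f0)//|[K KP]] := vanishing_or_bounded hf f0.
  by exists K => N N0; rewrite normcM (normc_prim w_prim) mul1r KP.
pose c : R := #|[pred f : idx | is_char f]|%:R.
have [N N0] := ln_nat_unbounded (1 + (mangoldt_inv_sum R q + 2) + (c * (mangoldt_inv_sum R B + 2) + K)).
rewrite ltNge => /negP; apply; rewrite -lerBlDl.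
have := sum_char_mangoldt_sum N cl.
rewrite (bigD1 (0 : idx)) ?is_char0//= -/c ffunE expr0 mul1r => E.
(* Orthogonality solved for the principal character: the class sum and the other characters are all
   bounded, against T_N >= log N - O(1). *)
have : normc (mangoldt_sum (chi 0) N) <= c * (mangoldt_inv_sum R B + 2) + K.
  move/(canRL (addrK _)): E => ->; apply: le_trans (normcB _ _) _; apply: lerD.
    rewrite normc_real ger0_norm ?ler_wpM2l ?ler0n//.
    by rewrite mulr_ge0 ?ler0n// sumr_ge0// => k _; rewrite mangoldt_div_ge0.
  by apply: le_trans (normc_sum _ _ _) _; exact: KP.
apply: le_trans; rewrite mangoldt_sum_char0 normc_real.
apply: le_trans (ler_norm _).
have := mangoldt_inv_sum_lower R N0; rewrite {1}/mangoldt_inv_sum (bigID (coprime q))/=.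
by have := nc_le N; lra.
Qed.

End Dirichlet.

Theorem primes_in_progression (q l B : nat) : (1 < q)%N -> coprime q l ->
  exists2 p, prime p & (B < p)%N && (p == l %[mod q]).
Proof.
case: q => [|[|q']]// _ cl.
have U0 : (0 < #|{: {unit 'Z_q'.+2}}|)%N by rewrite (cardD1 1%g).
have [w] := prim_root_exists Rdefinitions.R[i] (ltn0Sn #|{: {unit 'Z_q'.+2}}|.-1).
by move/primes_mod_unbounded; apply.
Qed.

Local Close Scope complex_scope.
Local Open Scope classical_set_scope.

Theorem theorem5p1 (a q : int) (ha : 1 <= a) (hq : 1 <= q)
    (haq : gcdz a q = 1) :
  infinite_set (prime_solutions a q).
Proof.
case: a q ha hq haq => [l|//] [m|//] _ m0 haq.
have cml : coprime m l by move/eqP: haq; rewrite coprime_sym /gcdz eqz_nat.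
move=> /finite_seqP[s sE].
pose B := \max_(xy <- s) `|xy.2|%N.
have [p p_pr /andP[Bp /eqP pl]] : exists2 p, prime p & (B < p)%N && (p == l %[mod m]).
  (* [primes_in_progression] starts at modulus 2; for modulus 1 any prime above B will do. *)
  have [m1|m1] := leqP m 1; last exact: primes_in_progression.
  have [p Bp p_pr] := prime_above B; exists p => //.
  have -> : m = 1%N by apply/eqP; rewrite eqn_leq m1.
  by rewrite Bp !modn1 eqxx.
(* p and l leave the same remainder modulo m, so the difference of the quotients, possibly negative,
   is (p - l)/m. *)
pose x : int := (p %/ m)%N%:Z - (l %/ m)%N%:Z.
have : prime_solutions l m (x, p%:Z).
  split; last by exists p.
  have pE : p%:Z = (p %/ m)%N%:Z * m%:Z + (l %% m)%N%:Z.
    by rewrite -pl -PoszM -PoszD -divn_eq.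
  have lE : l%:Z = (l %/ m)%N%:Z * m%:Z + (l %% m)%N%:Z.
    by rewrite -PoszM -PoszD -divn_eq.
  by rewrite /x /= [LHS]pE [X in _ = _ + X]lE; ring.
rewrite sE /= => xs; have : (p <= B)%N.
  by rewrite /B (big_rem _ xs)/= leq_maxl.
by rewrite leqNgt Bp.
Qed.
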